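(* Let $R=k[X_0,\ldots,X_n]$ with $k$ a field, and let $M$ be a finitely generated graded $R$-module of dimension $d$. Let $\mu\in\mathbb{Z}\cup\{-\infty\}$. Then $$\mathfrak{K}^{\mu}_{M}\subseteq \mathfrak{C}^{\mu}_{M}\qquad\text{and}\qquad \widehat{\mathfrak{K}}^{\mu}_{M}\subseteq \widehat{\mathfrak{C}}^{\mu}_{M}.$$ Furthermore, if $\gamma=(\gamma_1,\ldots,\gamma_s)$ is a homogeneous (partial) system of parameters of $M$, $\varepsilon:=\dim H_1(\gamma;M)$ and $\sigma:=\sum_{i=1}^{s}(\deg\gamma_i-1)$, then: (i) for $\varepsilon\leq i<d-s$, $\widehat{\mathfrak{K}}^{\mu}_{M}\subseteq \mathfrak{C}^{i,\mu+\sigma}_{M/(\gamma)M}$; (ii) for $i\geq\varepsilon$, $\mathfrak{K}^{\mu}_{M}\subseteq \mathfrak{C}^{i,\mu+\sigma}_{M/(\gamma)M}$.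
   Context: $R$ has its standard grading, $\mathfrak m=(X_0,\ldots,X_n)$, $H^i_{\mathfrak m}$ is local cohomology. For a tuple $z=(z_1,\ldots,z_t)$ of homogeneous elements of $R$, $H_i(z;M)$ and $H^i(z;M)$ are the Koszul homology and cohomology modules of $z$ on $M$, graded so that the Koszul differentials have degree $0$ with $K_0(z;M)=M$ and $K^0(z;M)=M$ (so $H^i(z;M)\simeq H_{t-i}(z;M)[\deg z_1+\cdots+\deg z_t]$, where $N[h]_\nu=N_{h+\nu}$). For a graded $R$-module $H$ and a set $S$ of integers, $\mathrm{Ann}^{S}_R(H):=\{x\in R\mid (xH)_\nu=0\ \ \forall \nu\in S\}$ (a homogeneous ideal), and $\mathrm{Ann}_R^{>N}(H)$ is the case $S=\{\nu\in\mathbb{Z}\mid\nu>N\}$ (all integers if $N=-\infty$). Let $\mathcal{Z}_M$ be the set of tuples $z$ of homogeneous elements of $R$ such that $\dim M/(z)M=0$. With $d=\dim M$, define $$\mathfrak{K}^{\mu}_{M}:=\bigcap_{z\in\mathcal{Z}_M}\bigcap_{i}\mathrm{Ann}^{>\mu-i}_R(H^i(z;M)),\qquad \widehat{\mathfrak{K}}^{\mu}_{M}:=\bigcap_{z\in\mathcal{Z}_M}\bigcap_{i<d}\mathrm{Ann}^{>\mu-i}_R(H^i(z;M)),$$ $$\mathfrak{C}^{i,\mu}_{M}:=\mathrm{Ann}^{>\mu-i}_R(H^i_{\mathfrak m}(M)),\qquad \mathfrak{C}^{\mu}_{M}:=\bigcap_i\mathfrak{C}^{i,\mu}_M,\qquad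 \widehat{\mathfrak{C}}^{\mu}_{M}:=\bigcap_{i<d}\mathfrak{C}^{i,\mu}_M .$$ A homogeneous (partial) system of parameters $\gamma=(\gamma_1,\ldots,\gamma_s)$ of $M$ is a sequence of homogeneous elements of positive degree with $\dim M/(\gamma)M=d-s$. *)

(* Defs.v *)
From HB Require Import structures.
From mathcomp Require Import all_boot all_order all_algebra.
From mathcomp Require Import generic_quotient ring_quotient.
From mathcomp Require Import zify.
From mathcomp Require Import boolp classical_sets constructive_ereal.
(* the notations of mpoly and of constructive_ereal clash *)
From mathcomp Require Import -(notations) mpoly.
Set Implicit Arguments.
Unset Strict Implicit.
Unset Printing Implicit Defensive.
Import Order.TTheory GRing.Theory Num.Theory.
Local Open Scope classical_set_scope.
Local Open Scope ring_scope.
Local Open Scope quotient_scope.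

Notation "{ 'mpoly' R [ n ] }" := (mpoly n R) : type_scope.
Notation "d .-homog" := (ishomog1 d mdeg) : form_scope.

Section GradedSum.
Variables (V : zmodType) (c : int -> V -> V).
Hypothesis cD : forall d, {morph c d : x y / x + y}.
Hypothesis cK : forall d e x, c d (c e x) = if d == e then c e x else 0.

Lemma comp_of0 d : c d 0 = 0.
Proof. by apply: (addrI (c d 0)); rewrite -cD !addr0. Qed.

Lemma comp_sum_of (I : Type) (l : seq I) (g : I -> int) (F : I -> V) x :
    x = \sum_(i <- l) c (g i) (F i) ->
  forall s, uniq s -> {subset map g l <= s} -> x = \sum_(d <- s) c d x.
Proof.
move=> -> s us; elim: l => [|i l IHl] hs.
  by rewrite big_nil big1 // => d _; rewrite comp_of0.
rewrite big_cons; under [RHS]eq_bigr do rewrite cD.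
rewrite big_split /= -IHl; last by move=> d hd; apply: hs; rewrite inE hd orbT.
congr (_ + _); have si : g i \in s by apply: hs; rewrite inE eqxx.
rewrite (bigD1_seq (g i)) //= cK eqxx big1 ?addr0 // => d /negPf di.
by rewrite cK di.
Qed.
End GradedSum.

Section Lmod.
Variable R : comNzRingType.

Record submodule (V : lmodType R) := Submodule {
  sm_pred :> {pred V};
  sm_closed : submod_closed sm_pred
}.

HB.instance Definition _ V (N : submodule V) :=
  GRing.isSubmodClosed.Build R V (sm_pred N) (sm_closed N).
HB.instance Definition _ V (N : submodule V) :=
  GRing.isZmodClosed.Build V (sm_pred N) (GRing.submod_closedB (sm_closed N)).

Section QuotLmod.
Variables (V : lmodType R) (N : submodule V).

Definition lmquot := Quotient.quot (sm_pred N).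
HB.instance Definition _ := GRing.Zmodule.on lmquot.

Definition lmpi (x : V) : lmquot := \pi_lmquot x.

Lemma lmpiP x y : lmpi x = lmpi y <-> x - y \in N.
Proof. by rewrite /lmpi (Quotient.idealrBE (sm_pred N)); split=> [->|/eqP]. Qed.

Lemma lmpiD : {morph lmpi : x y / x + y}.
Proof. by move=> x y; rewrite /lmpi !piE. Qed.

Lemma lmpi0 : lmpi 0 = 0.
Proof. by apply: (addrI (lmpi 0)); rewrite -lmpiD !addr0. Qed.

Lemma lmpi_sum (J : Type) (s : seq J) (G : J -> V) :
  lmpi (\sum_(j <- s) G j) = \sum_(j <- s) lmpi (G j).
Proof. exact: (big_morph _ lmpiD lmpi0). Qed.

Lemma lmpi_repr (x : lmquot) : lmpi (repr x) = x.
Proof. exact: reprK. Qed.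

Definition lmquot_scale (a : R) (x : lmquot) := lmpi (a *: repr x).

Lemma lmquot_scaleE a x : lmquot_scale a (lmpi x) = lmpi (a *: x).
Proof.
by apply/lmpiP; rewrite -scalerBr rpredZ //; apply/lmpiP; rewrite lmpi_repr.
Qed.

Fact lmquot_scaleA a b x :
  lmquot_scale a (lmquot_scale b x) = lmquot_scale (a * b) x.
Proof. by rewrite -[x]lmpi_repr !lmquot_scaleE scalerA. Qed.

Fact lmquot_scale1 : left_id 1 lmquot_scale.
Proof. by move=> x; rewrite -[x]lmpi_repr lmquot_scaleE scale1r. Qed.

Fact lmquot_scaleDr : right_distributive lmquot_scale +%R.
Proof.
move=> a x y; rewrite -[x]lmpi_repr -[y]lmpi_repr -lmpiD !lmquot_scaleE.
by rewrite -lmpiD scalerDr.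
Qed.

Fact lmquot_scaleDl x : {morph lmquot_scale^~ x : a b / a + b}.
Proof.
by move=> a b; rewrite -[x]lmpi_repr !lmquot_scaleE -lmpiD scalerDl.
Qed.

HB.instance Definition _ := GRing.Zmodule_isLmodule.Build R lmquot
  lmquot_scaleA lmquot_scale1 lmquot_scaleDr lmquot_scaleDl.

Lemma lmpiZ a x : lmpi (a *: x) = a *: lmpi x.
Proof. by rewrite -lmquot_scaleE. Qed.

End QuotLmod.

Section SubLmod.
Variables (V : lmodType R) (N : submodule V).

Definition sublm := {x : V | x \in N}.
HB.instance Definition _ := [isSub of sublm for @sval V (fun x => x \in N)].
HB.instance Definition _ := [Choice of sublm by <:].
HB.instance Definition _ := [SubChoice_isSubLmodule of sublm by <:].
End SubLmod.

Section ProdLmod.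
Variables (I : finType) (F : I -> lmodType R).

Definition dprod := {dffun forall i : I, F i}.
HB.instance Definition _ := Choice.on dprod.

Implicit Types f g h : dprod.
Definition mkdprod (f : forall i, F i) : dprod := @finfun I F f.

Lemma mkdprodE (f : forall i, F i) i : mkdprod f i = f i.
Proof. exact: ffunE. Qed.

Lemma dprodP f g : (forall i, f i = g i) <-> f = g.
Proof. exact: ffunP. Qed.

Definition dprod_add f g := mkdprod (fun i => f i + g i).
Definition dprod_opp f := mkdprod (fun i => - f i).
Definition dprod_scale (a : R) f := mkdprod (fun i => a *: f i).

Fact dprod_addA : associative dprod_add.
Proof. by move=> f g h; apply/dprodP=> i; rewrite !mkdprodE addrA. Qed.
Fact dprod_addC : commutative dprod_add.
Proof. by move=> f g; apply/dprodP=> i; rewrite !mkdprodE addrC. Qed.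
Fact dprod_add0 : left_id (mkdprod (fun i => 0)) dprod_add.
Proof. by move=> f; apply/dprodP=> i; rewrite !mkdprodE add0r. Qed.
Fact dprod_addN : left_inverse (mkdprod (fun i => 0)) dprod_opp dprod_add.
Proof. by move=> f; apply/dprodP=> i; rewrite !mkdprodE addNr. Qed.

HB.instance Definition _ := GRing.isZmodule.Build dprod
  dprod_addA dprod_addC dprod_add0 dprod_addN.

Fact dprod_scaleA a b f : dprod_scale a (dprod_scale b f) = dprod_scale (a * b) f.
Proof. by apply/dprodP=> i; rewrite !mkdprodE scalerA. Qed.
Fact dprod_scale1 : left_id 1 dprod_scale.
Proof. by move=> f; apply/dprodP=> i; rewrite !mkdprodE scale1r. Qed.
Fact dprod_scaleDr : right_distributive dprod_scale +%R.
Proof. by move=> a f g; apply/dprodP=> i; rewrite !mkdprodE scalerDr. Qed.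
Fact dprod_scaleDl f : {morph dprod_scale^~ f : a b / a + b}.
Proof. by move=> a b; apply/dprodP=> i; rewrite !mkdprodE scalerDl. Qed.

HB.instance Definition _ := GRing.Zmodule_isLmodule.Build R dprod
  dprod_scaleA dprod_scale1 dprod_scaleDr dprod_scaleDl.

Lemma dprodDE f g i : (f + g) i = f i + g i. Proof. exact: mkdprodE. Qed.
Lemma dprod0E i : (0 : dprod) i = 0. Proof. exact: mkdprodE. Qed.
Lemma dprodZE a f i : (a *: f) i = a *: f i. Proof. exact: mkdprodE. Qed.

Lemma dprod_sumE (J : Type) (s : seq J) (G : J -> dprod) i :
  (\sum_(j <- s) G j) i = \sum_(j <- s) G j i.
Proof.
by elim: s => [|j s IHs]; rewrite ?big_nil ?dprod0E // !big_cons dprodDE IHs.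
Qed.
End ProdLmod.

(* M_f: the class of (m, a) is m / f ^ a. *)
Section Localization.
Variables (M : lmodType R) (f : R).

Definition loc_eq (u v : M * nat) : bool :=
  `[< exists c, f ^+ (c + v.2) *: u.1 = f ^+ (c + u.2) *: v.1 >].

Fact loc_eq_equiv : equiv_class_of loc_eq.
Proof.
split=> [u|u v|v u w].
- by apply/asboolP; exists 0%N.
- by apply/asboolP/asboolP=> -[c E]; exists c.
- move=> /asboolP[c E] /asboolP[d E']; apply/asboolP; exists (c + d + v.2)%N.
  have -> : (c + d + v.2 + w.2 = d + w.2 + (c + v.2))%N by lia.
  have -> : (c + d + v.2 + u.2 = c + u.2 + (d + v.2))%N by lia.
  by rewrite exprD -scalerA E scalerA mulrC -scalerA E' scalerA -exprD.
Qed.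
Canonical loc_equivRel := EquivRelPack loc_eq_equiv.

Definition loc := {eq_quot loc_eq}.
HB.instance Definition _ := Choice.on loc.
HB.instance Definition _ := EqQuotient.on loc.

Definition mkloc (m : M) (a : nat) : loc := \pi_loc (m, a).

Lemma mklocP m a m' a' : mkloc m a = mkloc m' a' <->
  exists c, f ^+ (c + a') *: m = f ^+ (c + a) *: m'.
Proof.
split=> [/eqP|[c E]]; first by rewrite /mkloc piE => /asboolP.
by apply/eqP; rewrite /mkloc piE; apply/asboolP; exists c.
Qed.

Lemma mkloc_repr (x : loc) : mkloc (repr x).1 (repr x).2 = x.
Proof. by rewrite /mkloc -surjective_pairing reprK. Qed.

Lemma mkloc_mul b m a : mkloc (f ^+ b *: m) (b + a) = mkloc m a.
Proof. by apply/mklocP; exists 0%N; rewrite scalerA -exprD; congr (_ ^+ _ *: _); lia. Qed.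

Definition loc_add (x y : loc) : loc :=
  mkloc (f ^+ (repr y).2 *: (repr x).1 + f ^+ (repr x).2 *: (repr y).1)
        ((repr x).2 + (repr y).2).
Definition loc_opp (x : loc) : loc := mkloc (- (repr x).1) (repr x).2.
Definition loc_scale (r : R) (x : loc) : loc :=
  mkloc (r *: (repr x).1) (repr x).2.

Lemma loc_addE m a m' a' : loc_add (mkloc m a) (mkloc m' a') =
  mkloc (f ^+ a' *: m + f ^+ a *: m') (a + a').
Proof.
rewrite /loc_add; set s := repr _; set r := repr _.
have /mklocP[c E] := mkloc_repr (mkloc m a).
have /mklocP[d E'] := mkloc_repr (mkloc m' a').
rewrite -/r -/s in E E'; apply/mklocP; exists (c + d)%N.
rewrite !scalerDr !scalerA -!exprD; congr (_ + _).
  have -> : (c + d + (a + a') + s.2 = (d + a' + s.2) + (c + a))%N by lia.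
  have -> : (c + d + (r.2 + s.2) + a' = (d + a' + s.2) + (c + r.2))%N by lia.
  by rewrite exprD -scalerA E scalerA -exprD.
have -> : (c + d + (a + a') + r.2 = (c + a + r.2) + (d + a'))%N by lia.
have -> : (c + d + (r.2 + s.2) + a = (c + a + r.2) + (d + s.2))%N by lia.
by rewrite exprD -scalerA E' scalerA -exprD.
Qed.

Lemma loc_addE2 m m' a :
  loc_add (mkloc m a) (mkloc m' a) = mkloc (m + m') a.
Proof. by rewrite loc_addE -scalerDr mkloc_mul. Qed.

Lemma loc_oppE m a : loc_opp (mkloc m a) = mkloc (- m) a.
Proof.
rewrite /loc_opp; have /mklocP[c E] := mkloc_repr (mkloc m a).
by apply/mklocP; exists c; rewrite !scalerN E.
Qed.

Lemma loc_scaleE r m a : loc_scale r (mkloc m a) = mkloc (r *: m) a.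
Proof.
rewrite /loc_scale; have /mklocP[c E] := mkloc_repr (mkloc m a).
by apply/mklocP; exists c; rewrite !scalerA !(mulrC _ r) -!scalerA E.
Qed.

Lemma loc_common (x y : loc) :
  exists m m' a, x = mkloc m a /\ y = mkloc m' a.
Proof.
exists (f ^+ (repr y).2 *: (repr x).1), (f ^+ (repr x).2 *: (repr y).1).
exists ((repr y).2 + (repr x).2)%N; split.
  by rewrite mkloc_mul mkloc_repr.
by rewrite addnC mkloc_mul mkloc_repr.
Qed.

Fact loc_addC : commutative loc_add.
Proof.
by move=> x y; have [m [m' [a [-> ->]]]] := loc_common x y;
  rewrite !loc_addE2 addrC.
Qed.
Fact loc_addA : associative loc_add.
Proof.
move=> x y z; rewrite -[x]mkloc_repr -[y]mkloc_repr -[z]mkloc_repr !loc_addE.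
rewrite !scalerDr !scalerA -!exprD addrA addnA; congr mkloc.
by congr (_ *: _ + _ *: _ + _); congr (_ ^+ _); rewrite addnC.
Qed.
Fact loc_add0 : left_id (mkloc 0 0) loc_add.
Proof.
by move=> x; rewrite -[x]mkloc_repr loc_addE scaler0 add0r expr0 scale1r.
Qed.
Fact loc_addN : left_inverse (mkloc 0 0) loc_opp loc_add.
Proof.
move=> x; rewrite -[x]mkloc_repr loc_oppE loc_addE2 addNr.
by apply/mklocP; exists 0%N; rewrite !scaler0.
Qed.
HB.instance Definition _ := GRing.isZmodule.Build loc
  loc_addA loc_addC loc_add0 loc_addN.

Fact loc_scaleA r s x : loc_scale r (loc_scale s x) = loc_scale (r * s) x.
Proof. by rewrite -[x]mkloc_repr !loc_scaleE scalerA. Qed.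
Fact loc_scale1 : left_id 1 loc_scale.
Proof. by move=> x; rewrite -[x]mkloc_repr loc_scaleE scale1r. Qed.
Fact loc_scaleDr : right_distributive loc_scale +%R.
Proof.
move=> r x y; have [m [m' [a [-> ->]]]] := loc_common x y.
have -> : mkloc m a + mkloc m' a = mkloc (m + m') a by exact: loc_addE2.
by rewrite !loc_scaleE [RHS]loc_addE2 scalerDr.
Qed.
Fact loc_scaleDl x : {morph loc_scale^~ x : r s / r + s}.
Proof.
move=> r s; rewrite -[x]mkloc_repr !loc_scaleE [RHS]loc_addE2.
by rewrite scalerDl.
Qed.
HB.instance Definition _ := GRing.Zmodule_isLmodule.Build R loc
  loc_scaleA loc_scale1 loc_scaleDr loc_scaleDl.

Lemma mkloc0 a : mkloc 0 a = 0.
Proof. by apply/mklocP; exists 0%N; rewrite !scaler0. Qed.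
Lemma mklocD m m' a : mkloc (m + m') a = mkloc m a + mkloc m' a.
Proof. exact/esym/loc_addE2. Qed.
Lemma mklocZ r m a : mkloc (r *: m) a = r *: mkloc m a.
Proof. exact/esym/loc_scaleE. Qed.
Lemma mkloc_sum (J : Type) (s : seq J) (G : J -> M) a :
  mkloc (\sum_(j <- s) G j) a = \sum_(j <- s) mkloc (G j) a.
Proof.
by elim: s => [|j s IHs]; rewrite ?big_nil ?mkloc0 // !big_cons mklocD IHs.
Qed.
End Localization.

(* For g = h * f, the canonical map M_f -> M_g. *)
Section LocMap.
Variables (M : lmodType R) (f g h : R).

Definition locmap (x : loc M f) : loc M g :=
  mkloc g (h ^+ (repr x).2 *: (repr x).1) (repr x).2.

Hypothesis ghf : g = h * f.

Lemma locmapE m a : locmap (mkloc f m a) = mkloc g (h ^+ a *: m) a.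
Proof.
rewrite /locmap; have /mklocP[c E] := mkloc_repr (mkloc f m a).
apply/mklocP; exists c; rewrite !scalerA ghf !exprMn.
set r := repr _ in E *.
have -> : h ^+ (c + a) * f ^+ (c + a) * h ^+ r.2 =
  h ^+ (c + a + r.2) * f ^+ (c + a) by rewrite [h ^+ (c + a + _)]exprD mulrAC.
have -> : h ^+ (c + r.2) * f ^+ (c + r.2) * h ^+ a =
  h ^+ (c + a + r.2) * f ^+ (c + r.2) by rewrite mulrAC -exprD addnAC.
by rewrite -!scalerA E.
Qed.

Lemma locmap_linear : linear locmap.
Proof.
move=> r x y; have [m [m' [a [-> ->]]]] := loc_common x y.
rewrite -mklocZ -mklocD !locmapE -mklocZ -mklocD.
by rewrite scalerDr !scalerA mulrC.
Qed.
End LocMap.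
End Lmod.

Section Graded.
Variables (k : fieldType) (n : nat).
Local Notation R := {mpoly k[n]}.

(* A graded module, given by the projections onto its homogeneous components. *)
Record gmodule := GModule {
  gm_sort :> lmodType R;
  gcomp : int -> gm_sort -> gm_sort;
  gcompD : forall d, {morph gcomp d : x y / x + y};
  gcompK : forall d e x, gcomp d (gcomp e x) = if d == e then gcomp e x else 0;
  gcomp_sum : forall x, exists2 s : seq int, uniq s & x = \sum_(d <- s) gcomp d x;
  gcompZ : forall (e : nat) (f : R) d x, f \is e.-homog ->
    gcomp (d + e%:Z) (f *: x) = f *: gcomp d x
}.

Lemma gcomp0 (M : gmodule) d : gcomp d (0 : M) = 0.
Proof. exact/comp_of0/gcompD. Qed.

Lemma gcompN (M : gmodule) d (x : M) : gcomp d (- x) = - gcomp d x.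
Proof. by apply: (addrI (gcomp d x)); rewrite -gcompD !subrr gcomp0. Qed.

Lemma gcomp_bigsum (M : gmodule) d (J : Type) (s : seq J) (P : pred J)
    (G : J -> M) :
  gcomp d (\sum_(j <- s | P j) G j) = \sum_(j <- s | P j) gcomp d (G j).
Proof. exact: (big_morph _ (gcompD d) (gcomp0 M d)). Qed.

Lemma gcompZi (M : gmodule) (e : nat) (f : R) d (x : M) : f \is e.-homog ->
  gcomp d (f *: x) = f *: gcomp (d - e%:Z) x.
Proof. by move=> hf; rewrite -(gcompZ _ _ hf) subrK. Qed.

Definition finitely_generated (M : lmodType R) : Prop :=
  exists r (g : 'I_r -> M), forall x, exists a : 'I_r -> R,
    x = \sum_i a i *: g i.

Section Shift.
Variables (M : gmodule) (h : int).
Definition gshift_comp (d : int) (x : M) : M := gcomp (h + d) x.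

Fact gshift_compD d : {morph gshift_comp d : x y / x + y}.
Proof. exact: gcompD. Qed.
Fact gshift_compK d e x :
  gshift_comp d (gshift_comp e x) = if d == e then gshift_comp e x else 0.
Proof. by rewrite /gshift_comp gcompK (inj_eq (addrI h)). Qed.
Fact gshift_sum x :
  exists2 s : seq int, uniq s & x = \sum_(d <- s) gshift_comp d x.
Proof.
have [s us E] := gcomp_sum x; exists (map (fun d => d - h) s).
  by rewrite map_inj_uniq // => d e /addIr.
rewrite big_map {1}E; apply: eq_bigr => d _.
by rewrite /gshift_comp addrC subrK.
Qed.
Fact gshift_compZ (e : nat) (f : R) d x : f \is e.-homog ->
  gshift_comp (d + e%:Z) (f *: x) = f *: gshift_comp d x.
Proof. by move=> hf; rewrite /gshift_comp addrA (gcompZ _ _ hf). Qed.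

(* M[h], with M[h]_d = M_(h + d) *)
Definition gshift : gmodule :=
  GModule gshift_compD gshift_compK gshift_sum gshift_compZ.
End Shift.

Record gsub (M : gmodule) := GSub {
  gs_sub :> submodule M;
  gs_comp : forall d x, x \in gs_sub -> gcomp d x \in gs_sub
}.

Section Quotient.
Variables (M : gmodule) (N : gsub M).
Definition gquot_comp (d : int) (x : lmquot N) : lmquot N :=
  lmpi N (gcomp d (repr x)).

Lemma gquot_compE d x : gquot_comp d (lmpi N x) = lmpi N (gcomp d x).
Proof.
have /lmpiP h : lmpi N (repr (lmpi N x)) = lmpi N x by rewrite lmpi_repr.
apply/lmpiP; have := gs_comp d h.
by rewrite gcompD gcompN.
Qed.

Fact gquot_compD d : {morph gquot_comp d : x y / x + y}.
Proof.
move=> x y; rewrite -[x]lmpi_repr -[y]lmpi_repr -lmpiD !gquot_compE gcompD.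
by rewrite lmpiD.
Qed.
Fact gquot_compK d e x :
  gquot_comp d (gquot_comp e x) = if d == e then gquot_comp e x else 0.
Proof.
rewrite -[x]lmpi_repr !gquot_compE gcompK; case: eqP => // _.
by rewrite lmpi0.
Qed.
Fact gquot_sum x :
  exists2 s : seq int, uniq s & x = \sum_(d <- s) gquot_comp d x.
Proof.
have [s us E] := gcomp_sum (repr x); exists s => //.
rewrite -[LHS]lmpi_repr E lmpi_sum; apply: eq_bigr => d _.
by rewrite -gquot_compE lmpi_repr.
Qed.
Fact gquot_compZ (e : nat) (f : R) d x : f \is e.-homog ->
  gquot_comp (d + e%:Z) (f *: x) = f *: gquot_comp d x.
Proof.
move=> hf; rewrite -[x]lmpi_repr -lmpiZ !gquot_compE (gcompZ _ _ hf).
exact: lmpiZ.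
Qed.

Definition gquot : gmodule :=
  GModule gquot_compD gquot_compK gquot_sum gquot_compZ.
End Quotient.

Section Sub.
Variables (M : gmodule) (N : gsub M).
Definition gsubm_comp (d : int) (x : sublm N) : sublm N :=
  exist (fun x => x \in gs_sub N) (gcomp d (val x)) (gs_comp d (valP x)).

Fact gsubm_compD d : {morph gsubm_comp d : x y / x + y}.
Proof. by move=> x y; apply/val_inj; rewrite /= gcompD. Qed.
Fact gsubm_compK d e x :
  gsubm_comp d (gsubm_comp e x) = if d == e then gsubm_comp e x else 0.
Proof. by apply/val_inj; rewrite /= gcompK; case: eqP. Qed.
Fact gsubm_sum x :
  exists2 s : seq int, uniq s & x = \sum_(d <- s) gsubm_comp d x.
Proof.
have [s us E] := gcomp_sum (val x); exists s => //.
by apply/val_inj; rewrite raddf_sum.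
Qed.
Fact gsubm_compZ (e : nat) (f : R) d x : f \is e.-homog ->
  gsubm_comp (d + e%:Z) (f *: x) = f *: gsubm_comp d x.
Proof. by move=> hf; apply/val_inj; rewrite /= (gcompZ _ _ hf). Qed.

Definition gsubm : gmodule :=
  GModule gsubm_compD gsubm_compK gsubm_sum gsubm_compZ.
End Sub.

Section Prod.
Variables (I : finType) (F : I -> gmodule).
Local Notation P := (dprod (fun i => gm_sort (F i))).
Definition gprod_comp (d : int) (x : P) : P :=
  mkdprod (fun i => gcomp d (x i)).

Fact gprod_compD d : {morph gprod_comp d : x y / x + y}.
Proof.
by move=> x y; apply/dprodP => i; rewrite dprodDE !mkdprodE gcompD.
Qed.
Fact gprod_compK d e x :
  gprod_comp d (gprod_comp e x) = if d == e then gprod_comp e x else 0.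
Proof.
apply/dprodP => i; rewrite !mkdprodE gcompK.
by case: eqP => _; rewrite ?mkdprodE ?dprod0E.
Qed.
Fact gprod_sum x :
  exists2 s : seq int, uniq s & x = \sum_(d <- s) gprod_comp d x.
Proof.
have /choice[s hs] : forall i, exists s : seq int,
    uniq s /\ x i = \sum_(d <- s) gcomp d (x i).
  by move=> i; have [s us E] := gcomp_sum (x i); exists s.
exists (undup (flatten [seq s i | i <- enum I])); first exact: undup_uniq.
apply/dprodP => i; rewrite dprod_sumE.
under eq_bigr do rewrite mkdprodE.
apply: (comp_sum_of (@gcompD (F i)) (@gcompK (F i)) (hs i).2 (undup_uniq _)).
move=> d; rewrite map_id mem_undup => hd; apply/flattenP.
by exists (s i) => //; apply/map_f; rewrite mem_enum.
Qed.
Fact gprod_compZ (e : nat) (f : R) d x : f \is e.-homog ->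
  gprod_comp (d + e%:Z) (f *: x) = f *: gprod_comp d x.
Proof.
move=> hf; apply/dprodP => i.
by rewrite dprodZE !mkdprodE (gcompZ _ _ hf).
Qed.

Definition gprod : gmodule :=
  GModule gprod_compD gprod_compK gprod_sum gprod_compZ.
End Prod.

Section Loc.
Variables (M : gmodule) (f : R) (e : nat) (hf : f \is e.-homog).
Definition gloc_comp (d : int) (x : loc M f) : loc M f :=
  mkloc f (gcomp (d + (e * (repr x).2)%:Z) (repr x).1) (repr x).2.

Lemma homogXn a : f ^+ a \is (e * a).-homog.
Proof. exact: dhomogMn. Qed.

Lemma gloc_compE d m a :
  gloc_comp d (mkloc f m a) = mkloc f (gcomp (d + (e * a)%:Z) m) a.
Proof.
rewrite /gloc_comp; have /mklocP[c E] := mkloc_repr (mkloc f m a).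
apply/mklocP; exists c; move: E; set r := repr _ => E.
rewrite -!(gcompZ _ _ (homogXn _)) E; congr gcomp.
by rewrite -!addrA -!PoszD; congr (_ + Posz _); lia.
Qed.

Fact gloc_compD d : {morph gloc_comp d : x y / x + y}.
Proof.
move=> x y; have [m [m' [a [-> ->]]]] := loc_common x y.
by rewrite -mklocD !gloc_compE gcompD mklocD.
Qed.
Fact gloc_compK d d' x :
  gloc_comp d (gloc_comp d' x) = if d == d' then gloc_comp d' x else 0.
Proof.
rewrite -[x]mkloc_repr !gloc_compE gcompK (inj_eq (addIr _)).
by case: eqP => // _; rewrite mkloc0.
Qed.
Fact gloc_sum x :
  exists2 s : seq int, uniq s & x = \sum_(d <- s) gloc_comp d x.
Proof.
rewrite -[x]mkloc_repr; move: (repr x) => [m a] /=.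
have [s us E] := gcomp_sum m; exists (map (fun d => d - (e * a)%:Z) s).
  by rewrite map_inj_uniq // => d d' /addIr.
rewrite big_map {1}E mkloc_sum; apply: eq_bigr => d _.
by rewrite gloc_compE subrK.
Qed.
Fact gloc_compZ (d' : nat) (g : R) d x : g \is d'.-homog ->
  gloc_comp (d + d'%:Z) (g *: x) = g *: gloc_comp d x.
Proof.
move=> hg; rewrite -[x]mkloc_repr -mklocZ !gloc_compE addrAC (gcompZ _ _ hg).
exact: mklocZ.
Qed.

Definition gloc : gmodule :=
  GModule gloc_compD gloc_compK gloc_sum gloc_compZ.
End Loc.

Record ghom (M N : gmodule) := GHom {
  gh_fun :> M -> N;
  gh_linear : linear gh_fun;
  gh_comp : forall d x, gh_fun (gcomp d x) = gcomp d (gh_fun x)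
}.

Lemma gh0 M N (u : ghom M N) : u 0 = 0.
Proof.
apply: (addrI (u 0)); rewrite addr0.
by have := gh_linear u 1 0 0; rewrite !scale1r addr0.
Qed.

Section SubConstructions.
Variables (M N : gmodule) (u : ghom M N).

Definition gpre_pred (B : gsub N) : {pred M} := [pred x | u x \in gs_sub B].
Fact gpre_closed B : submod_closed (gpre_pred B).
Proof.
split=> [|a x y]; rewrite !inE ?gh0 ?rpred0 // => hx hy.
by rewrite gh_linear rpredD ?rpredZ.
Qed.
Fact gpre_comp B d x :
  x \in Submodule (gpre_closed B) -> gcomp d x \in Submodule (gpre_closed B).
Proof. by rewrite !inE gh_comp; apply: gs_comp. Qed.
Definition gpre B : gsub M := GSub (@gpre_comp B).

Definition gker_pred : {pred M} := [pred x | u x == 0].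
Fact gker_closed : submod_closed gker_pred.
Proof.
split=> [|a x y]; rewrite !inE ?gh0 // => /eqP hx /eqP hy.
by rewrite gh_linear hx hy scaler0 addr0.
Qed.
Fact gker_comp d x :
  x \in Submodule gker_closed -> gcomp d x \in Submodule gker_closed.
Proof. by rewrite !inE gh_comp => /eqP->; rewrite gcomp0. Qed.
Definition gker : gsub M := GSub gker_comp.

Definition gim_pred (A : gsub M) : {pred N} :=
  fun y => `[< exists2 x, x \in gs_sub A & y = u x >].
Fact gim_closed A : submod_closed (gim_pred A).
Proof.
split=> [|a y y'].
  by apply/asboolP; exists 0; rewrite ?rpred0 ?gh0.
move=> /asboolP[x hx ->] /asboolP[x' hx' ->]; apply/asboolP.
by exists (a *: x + x'); rewrite ?gh_linear // rpredD ?rpredZ.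
Qed.
Fact gim_comp A d y :
  y \in Submodule (gim_closed A) -> gcomp d y \in Submodule (gim_closed A).
Proof.
move=> /asboolP[x hx ->]; apply/asboolP; exists (gcomp d x); first exact: gs_comp.
by rewrite gh_comp.
Qed.
Definition gim A : gsub N := GSub (@gim_comp A).
End SubConstructions.

Section Cap.
Variables (M : gmodule) (A B : gsub M).
Definition gcap_pred : {pred M} :=
  [pred x | (x \in gs_sub A) && (x \in gs_sub B)].
Fact gcap_closed : submod_closed gcap_pred.
Proof.
split=> [|a x y]; rewrite !inE ?rpred0 // => /andP[xA xB] /andP[yA yB].
by rewrite !rpredD ?rpredZ.
Qed.
Fact gcap_comp d x :
  x \in Submodule gcap_closed -> gcomp d x \in Submodule gcap_closed.
Proof. by rewrite !inE => /andP[xA xB]; rewrite !gs_comp. Qed.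
Definition gcap : gsub M := GSub gcap_comp.
End Cap.

Section Incl.
Variables (M : gmodule) (A : gsub M).
Fact gincl_linear : linear (fun x : gsubm A => val x : M).
Proof. by []. Qed.
Definition gincl : ghom (gsubm A) M :=
  @GHom (gsubm A) M (fun x => val x) gincl_linear (fun _ _ => erefl).
End Incl.

(* (ker D \cap A) / (D(B) \cap ker D \cap A): for a complex with total module V
   and differential D, A the degree p part and B the part mapped to A by D,
   this is the p-th homology module. *)
Definition ghomology (V : gmodule) (D : ghom V V) (A B : gsub V) : gmodule :=
  let Z := gcap A (gker D) in gquot (gpre (gincl Z) (gim D B)).

Section Supp.
Variables (I : finType) (F : I -> gmodule) (P : pred I).
Definition gsupp_pred : {pred gprod F} :=
  [pred x : gprod F | [forall i, P i || (x i == 0)]].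
Fact gsupp_closed : submod_closed gsupp_pred.
Proof.
split=> [|a x y]; rewrite !inE.
  by apply/forallP => i; rewrite dprod0E eqxx orbT.
move=> /forallP hx /forallP hy; apply/forallP => i; rewrite dprodDE dprodZE.
have := hx i; have := hy i; case: (P i) => //= /eqP-> /eqP->.
by rewrite scaler0 addr0.
Qed.
Fact gsupp_comp d x :
  x \in Submodule gsupp_closed -> gcomp d x \in Submodule gsupp_closed.
Proof.
rewrite !inE => /forallP hx; apply/forallP => i; have := hx i.
case: (P i) => //= /eqP E; rewrite mkdprodE E gcomp0; exact/eqP.
Qed.
(* the sum of the factors F i with P i *)
Definition gsupp : gsub (gprod F) := GSub gsupp_comp.
End Supp.

(* The degrees are data because 0 is homogeneous of every degree. *)
Record htuple (t : nat) := HTuple {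
  ht_val :> 'I_t -> R;
  ht_deg : 'I_t -> nat;
  ht_homog : forall i, ht_val i \is (ht_deg i).-homog
}.

Section Tuple.
Variables (t : nat) (z : htuple t) (M : gmodule).

Definition tmul_pred : {pred M} :=
  fun x => `[< exists m : 'I_t -> M, x = \sum_i z i *: m i >].
Fact tmul_closed : submod_closed tmul_pred.
Proof.
split=> [|a x y].
  by apply/asboolP; exists (fun=> 0); rewrite big1 // => i _; rewrite scaler0.
move=> /asboolP[m ->] /asboolP[m' ->]; apply/asboolP.
exists (fun i => a *: m i + m' i); rewrite scaler_sumr -big_split /=.
by apply: eq_bigr => i _; rewrite scalerDr !scalerA mulrC.
Qed.
Fact tmul_comp d x :
  x \in Submodule tmul_closed -> gcomp d x \in Submodule tmul_closed.
Proof.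
move=> /asboolP[m ->]; apply/asboolP.
exists (fun i => gcomp (d - (ht_deg z i)%:Z) (m i)); rewrite gcomp_bigsum.
by apply: eq_bigr => i _; rewrite (gcompZi _ _ (ht_homog z i)).
Qed.
Definition tmul : gsub M := GSub tmul_comp.

Definition tquot : gmodule := gquot tmul.

Definition sdeg (S : {set 'I_t}) : int := (\sum_(i in S) ht_deg z i)%N%:Z.
Definition ksign (i : 'I_t) (S : {set 'I_t}) : R :=
  (-1) ^+ #|[set j in S | (j < i)%N]|.

(* f stands for the sum of the f(S) e_S, where e_S has degree sdeg S and
   d(e_S) is the sum over i in S of the ksign i S * z_i * e_(S \ i). *)
Definition koszul_chains : gmodule :=
  gprod (fun S : {set 'I_t} => gshift M (- sdeg S)).
Definition koszul_d (f : koszul_chains) : koszul_chains :=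
  mkdprod (fun S : {set 'I_t} =>
    \sum_(i | i \notin S) ksign i S *: (z i *: (f (i |: S)%SET : M))
    : gshift M (- sdeg S)).

(* f stands for the cochain e_S |-> f(S). *)
Definition koszul_cochains : gmodule :=
  gprod (fun S : {set 'I_t} => gshift M (sdeg S)).
Definition koszul_codiff (f : koszul_cochains) : koszul_cochains :=
  mkdprod (fun S : {set 'I_t} =>
    \sum_(i in S) ksign i S *: (z i *: (f (S :\ i)%SET : M))
    : gshift M (sdeg S)).

Lemma ksign_homog i S : ksign i S \is 0.-homog.
Proof.
rewrite /ksign -signr_odd; case: odd; rewrite ?expr0 ?expr1 ?rpredN;
exact: dhomog1.
Qed.

Fact koszul_d_linear : linear koszul_d.
Proof.
move=> a f g; apply/dprodP => S; rewrite dprodDE dprodZE !mkdprodE.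
rewrite scaler_sumr -big_split /=; apply: eq_bigr => i _.
by rewrite dprodDE dprodZE /= !scalerDr !scalerA mulrAC [a * _]mulrC mulrAC.
Qed.
Fact koszul_d_comp d f : koszul_d (gcomp d f) = gcomp d (koszul_d f).
Proof.
apply/dprodP => S; rewrite !mkdprodE /= /gshift_comp gcomp_bigsum.
apply: eq_bigr => i hi; rewrite mkdprodE /= /gshift_comp.
rewrite (gcompZi _ _ (ksign_homog _ _)) subr0 (gcompZi _ _ (ht_homog z i)).
congr (_ *: (_ *: gcomp _ _)).
by rewrite /sdeg big_setU1 //= PoszD opprD [RHS]addrAC [- _ + _]addrC.
Qed.
Definition koszul_dhom := GHom koszul_d_linear koszul_d_comp.

Fact koszul_codiff_linear : linear koszul_codiff.
Proof.
move=> a f g; apply/dprodP => S; rewrite dprodDE dprodZE !mkdprodE.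
rewrite scaler_sumr -big_split /=; apply: eq_bigr => i _.
by rewrite dprodDE dprodZE /= !scalerDr !scalerA mulrAC [a * _]mulrC mulrAC.
Qed.
Fact koszul_codiff_comp d f :
  koszul_codiff (gcomp d f) = gcomp d (koszul_codiff f).
Proof.
apply/dprodP => S; rewrite !mkdprodE /= /gshift_comp gcomp_bigsum.
apply: eq_bigr => i hi; rewrite mkdprodE /= /gshift_comp.
rewrite (gcompZi _ _ (ksign_homog _ _)) subr0 (gcompZi _ _ (ht_homog z i)).
congr (_ *: (_ *: gcomp _ _)).
by rewrite /sdeg (big_setD1 i hi) /= PoszD addrAC [_ + _%:Z]addrC addrK.
Qed.
Definition koszul_codiffhom := GHom koszul_codiff_linear koszul_codiff_comp.

Definition koszul_homology (p : nat) : gmodule :=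
  ghomology koszul_dhom (gsupp _ (fun S : {set 'I_t} => #|S| == p))
                        (gsupp _ (fun S : {set 'I_t} => #|S| == p.+1)).

Definition koszul_cohomology (p : nat) : gmodule :=
  ghomology koszul_codiffhom (gsupp _ (fun S : {set 'I_t} => #|S| == p))
                             (gsupp _ (fun S : {set 'I_t} => #|S|.+1 == p)).
End Tuple.

(* Local cohomology H^p_m, m = (X_0, ..., X_(n-1)), as the cohomology of the
   Cech complex with terms the sums of the localizations of M at the products
   of p variables. *)
Section Cech.
Variable M : gmodule.

Definition varprod (S : {set 'I_n}) : R := \prod_(i in S) mpolyX k (mnm1 i).

Fact varprod_homog S : varprod S \is #|S|.-homog.
Proof.
rewrite /varprod -sum1_card.
have h (i : 'I_n) : mpolyX k (mnm1 i) \is 1%N.-homog by rewrite dhomogX; apply/eqP/mdeg1.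
by elim/big_rec2: _ => [|i d p _ hp]; rewrite ?dhomog1 // dhomogM.
Qed.

Definition cech_cochains : gmodule :=
  gprod (fun S : {set 'I_n} => gloc M (varprod_homog S)).

Definition cech_codiff (f : cech_cochains) : cech_cochains :=
  mkdprod (fun S : {set 'I_n} =>
    \sum_(i in S) ksign i S *:
      locmap (varprod S) (mpolyX k (mnm1 i)) (f (S :\ i)%SET)
    : gloc M (varprod_homog S)).

Fact varprodD1 (S : {set 'I_n}) i : i \in S ->
  varprod S = mpolyX k (mnm1 i) * varprod (S :\ i)%SET.
Proof. by move=> hi; rewrite /varprod (big_setD1 i). Qed.

Fact cech_codiff_linear : linear cech_codiff.
Proof.
move=> a f g; apply/dprodP => S; rewrite dprodDE dprodZE !mkdprodE.
rewrite scaler_sumr -big_split /=; apply: eq_bigr => i hi.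
have -> : (a *: f + g) (S :\ i)%SET = a *: f (S :\ i)%SET + g (S :\ i)%SET.
  by rewrite dprodDE dprodZE.
have -> := locmap_linear (M := M) (varprodD1 hi) a (f (S :\ i)%SET)
  (g (S :\ i)%SET).
apply: etrans (scalerDr _ _ _) _; congr (_ + _).
apply: etrans (scalerA _ _ _) _; apply: etrans _ (esym (scalerA _ _ _)).
by congr (_ *: _); exact: mulrC.
Qed.
Fact cech_codiff_comp d f : cech_codiff (gcomp d f) = gcomp d (cech_codiff f).
Proof.
apply/dprodP => S; rewrite !mkdprodE gcomp_bigsum.
apply: eq_bigr => i hi; rewrite (gcompZi _ _ (ksign_homog _ _)) subr0.
congr (_ *: _); rewrite mkdprodE; move: (f _) => x.
rewrite -[x]mkloc_repr; move: (repr x) => [m a] /=.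
rewrite (gloc_compE (varprod_homog _)).
have E m' := locmapE (varprodD1 hi) m' a.
rewrite !E (gloc_compE (varprod_homog _)); congr mkloc.
have hX : mpolyX k (mnm1 i) ^+ a \is (1 * a).-homog.
  by apply: dhomogMn; rewrite dhomogX; apply/eqP/mdeg1.
rewrite (gcompZi _ _ hX); congr (_ *: gcomp _ _).
rewrite [#|S|](cardsD1 i) hi mulnDl PoszD; lia.
Qed.
Definition cech_codiffhom := GHom cech_codiff_linear cech_codiff_comp.

Definition local_cohomology (p : nat) : gmodule :=
  ghomology cech_codiffhom (gsupp _ (fun S : {set 'I_n} => #|S| == p))
                           (gsupp _ (fun S : {set 'I_n} => #|S|.+1 == p)).
End Cech.

Definition annihilator (M : lmodType R) : set R :=
  [set x | forall m : M, x *: m = 0].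

Definition prime_chain (I : set R) (r : nat) : Prop :=
  exists p : nat -> {pred R},
    (forall i, (i <= r)%N -> [/\ idealr_closed (p i), prime_idealr_closed (p i)
                               & forall x, I x -> x \in p i]) /\
    (forall i, (i < r)%N -> {subset p i <= p i.+1} /\
                            exists2 x, x \in p i.+1 & x \notin p i).

(* dim R / Ann M, with dim 0 = -oo; every set in \bar int has a supremum. *)
Definition krull_dim (M : lmodType R) : \bar int :=
  supremum -oo%E [set (r%:Z)%:E | r in prime_chain (annihilator M)].

Definition ann_on (S : set int) (H : gmodule) : set R :=
  [set x | forall nu, S nu -> forall h : H, gcomp nu (x *: h) = 0].

Definition ann_gt (N : \bar int) (H : gmodule) : set R :=
  ann_on [set nu | (N < nu%:E)%E] H.

(* The set Z_M. A nonzero entry of degree 0 would give M / (z)M = 0; so the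
   condition on the degrees only prevents zero entries from being given
   degree 0. *)
Definition ZM (M : gmodule) (t : nat) : set (htuple t) :=
  [set z | (forall i, 0 < ht_deg z i)%N /\ krull_dim (tquot z M) = 0%E].

Definition KK (mu : \bar int) (M : gmodule) : set R :=
  [set x | forall t (z : htuple t), ZM M z -> forall i : nat,
     ann_gt (mu - (i%:Z)%:E)%E (koszul_cohomology z M i) x].

Definition KKhat (mu : \bar int) (M : gmodule) : set R :=
  [set x | forall t (z : htuple t), ZM M z -> forall i : nat,
     ((i%:Z)%:E < krull_dim M)%E ->
     ann_gt (mu - (i%:Z)%:E)%E (koszul_cohomology z M i) x].

Definition CCi (i : nat) (mu : \bar int) (M : gmodule) : set R :=
  ann_gt (mu - (i%:Z)%:E)%E (local_cohomology M i).

Definition CC (mu : \bar int) (M : gmodule) : set R :=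
  \bigcap_i CCi i mu M.

Definition CChat (mu : \bar int) (M : gmodule) : set R :=
  \bigcap_(i in [set i : nat | ((i%:Z)%:E < krull_dim M)%E]) CCi i mu M.

Definition partial_sop (M : gmodule) (s : nat) (gamma : htuple s) : Prop :=
  (forall i, 0 < ht_deg gamma i)%N /\
  krull_dim (tquot gamma M) = (krull_dim M - (s%:Z)%:E)%E.
End Graded.

(* Main.v *)
Require Import Defs.
From mathcomp Require Import all_boot all_order all_algebra.
From mathcomp Require Import ring_quotient zify ring.
From mathcomp Require Import boolp classical_sets functions constructive_ereal.
From mathcomp Require Import -(notations) mpoly.
Set Implicit Arguments.
Unset Strict Implicit.
Unset Printing Implicit Defensive.
Import Order.TTheory GRing.Theory Num.Theory.
Local Open Scope ring_scope.

(** Local cohomology is the colimit over [t] of the Koszul cohomology of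
    [y_t = (X_0 ^ t, ..., X_n ^ t)], which gives the first two inclusions at
    once: if [M] is nonzero then [y_t], and also [y_t] followed by any family
    of forms of positive degree, lies in [Z_M].

    For (i) and (ii), the Koszul cohomology of [(y_t, gamma)] on [M] is, up to
    a shift, the cohomology of the total complex of [K^*(y_t) (x) K_*(gamma; M)].
    In the colimit it maps to [H^i_m(M / (gamma)M)], and the obstructions to
    lifting a class along this map lie in [H^(i+q+1)_m(H_q(gamma; M))], [q > 0].
    These groups vanish for [i >= epsilon]: by rigidity of Koszul homology every
    element that kills [H_1(gamma; M)] has a power that kills [H_q(gamma; M)],
    and local cohomology vanishes above the dimension.

    The vanishing theorem holds for all modules killed by an ideal [J], finitely
    generated or not.  It goes by induction on [dim R / J], replacing [J] by
    [(J : x^oo) + (x)] for a variable [x], which lowers the dimension without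
    any recourse to minimal primes or prime avoidance. *)

(** * Submodules and ideals as predicates *)

Section Submod.
Variables (R : comNzRingType) (V : lmodType R).

(** A bare [Prop] predicate, since the submodules below are given by existential statements; on
    [R^o] it gives the ideals. *)
Definition submod (A : V -> Prop) : Prop :=
  A 0 /\ forall a u v, A u -> A v -> A (a *: u + v).

Variable A : V -> Prop.
Hypothesis sA : submod A.

Lemma submod0 : A 0. Proof. by case: sA. Qed.
Lemma submodD u v : A u -> A v -> A (u + v).
Proof. by move=> hu hv; rewrite -[u]scale1r; apply: sA.2. Qed.
Lemma submodZ a u : A u -> A (a *: u).
Proof. by move=> hu; rewrite -[_ *: _]addr0; apply: sA.2 => //; apply: submod0. Qed.
Lemma submodN u : A u -> A (- u).
Proof. by rewrite -scaleN1r; apply: submodZ. Qed.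
Lemma submodB u v : A u -> A v -> A (u - v).
Proof. by move=> hu hv; apply: submodD => //; apply: submodN. Qed.
Lemma submod_sum (I : Type) (r : seq I) (P : pred I) (F : I -> V) :
  (forall i, P i -> A (F i)) -> A (\sum_(i <- r | P i) F i).
Proof. by move=> hF; elim/big_ind: _ => //; [apply: submod0|apply: submodD]. Qed.
End Submod.

(** * Koszul differentials *)

Section Exterior.
Import mathcomp.boot.finset.
Variables (R : comNzRingType) (t : nat) (V : lmodType R).
Implicit Types (f g : {set 'I_t} -> V) (S T : {set 'I_t}) (z : 'I_t -> R).

Definition sgn (i : 'I_t) (S : {set 'I_t}) : R :=
  (-1) ^+ #|[set j in S | (j < i)%N]|.

(** With [f] read as the sum of the [f S] e_S, these are exterior multiplication by e_i and
    contraction against e_i. Their combinations with coefficients [z i] are the Koszul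
    codifferential [wedge z] and differential [contr z]. *)
Definition wedge1 i f S : V := if i \in S then sgn i S *: f (S :\ i) else 0.
Definition contr1 i f S : V := if i \in S then 0 else sgn i S *: f (i |: S).
Definition wedge z f S : V := \sum_(i in S) sgn i S *: (z i *: f (S :\ i)).
Definition contr z f S : V := \sum_(i | i \notin S) sgn i S *: (z i *: f (i |: S)).

Lemma sgnU1 i j S : j \notin S -> sgn i (j |: S) = (-1) ^+ (j < i)%N * sgn i S.
Proof.
move=> jS; rewrite /sgn -exprD; congr (_ ^+ _).
case: ltnP => ji; last first.
  rewrite add0n; apply: eq_card => l; rewrite !inE.
  by case: eqVneq => [->|//]; rewrite (negPf jS) ltnNge ji.
rewrite (_ : [set _ in _ | _] = j |: [set l in S | (l < i)%N]); last first.
  by apply/setP => l; rewrite !inE; case: eqVneq => [->|].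
by rewrite cardsU1 !inE (negPf jS).
Qed.

Lemma sgnD1 i j S : j \in S -> sgn i (S :\ j) = (-1) ^+ (j < i)%N * sgn i S.
Proof.
move=> jS; have := @sgnU1 i j (S :\ j); rewrite setD11 setD1K // => -> //.
rewrite mulrA -exprD addnn; by rewrite -signr_odd odd_double mul1r.
Qed.

Lemma sgnK i S : sgn i S * sgn i S = 1.
Proof. by rewrite /sgn -exprD addnn -signr_odd odd_double. Qed.

Lemma wedgeE z f S : wedge z f S = \sum_i z i *: wedge1 i f S.
Proof.
rewrite /wedge /wedge1 big_mkcond; apply: eq_bigr => i _.
by case: ifP => _; rewrite ?scaler0 // !scalerA mulrC.
Qed.

Lemma contrE z f S : contr z f S = \sum_i z i *: contr1 i f S.
Proof.
rewrite /contr /contr1 big_mkcond; apply: eq_bigr => i _.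
by case: (i \in S) => /=; rewrite ?scaler0 // !scalerA mulrC.
Qed.

Lemma wedge1_sum (I : finType) i (a : I -> R) (F : I -> {set 'I_t} -> V) S :
  wedge1 i (fun S => \sum_j a j *: F j S) S = \sum_j a j *: wedge1 i (F j) S.
Proof.
rewrite /wedge1; case: (i \in S) => /=; last by rewrite big1 // => j; rewrite scaler0.
by rewrite scaler_sumr; apply: eq_bigr => j _ /=; rewrite !scalerA mulrC.
Qed.

Lemma contr1_sum (I : finType) i (a : I -> R) (F : I -> {set 'I_t} -> V) S :
  contr1 i (fun S => \sum_j a j *: F j S) S = \sum_j a j *: contr1 i (F j) S.
Proof.
rewrite /contr1; case: (i \in S) => /=; first by rewrite big1 // => j; rewrite scaler0.
by rewrite scaler_sumr; apply: eq_bigr => j _; rewrite !scalerA mulrC.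
Qed.

Lemma signC i j : i != j :> 'I_t -> (-1) ^+ (i < j)%N = - (-1) ^+ (j < i)%N :> R.
Proof. by rewrite -val_eqE; case: ltngtP => //= _ _; rewrite !(expr0, expr1) ?opprK. Qed.

Lemma wedge1C i j f S : i != j ->
  wedge1 i (wedge1 j f) S = - wedge1 j (wedge1 i f) S.
Proof.
move=> ij; rewrite /wedge1 !inE (eq_sym j i) ij /=.
case: ifP => iS; case: ifP => jS; rewrite ?scaler0 ?oppr0 //.
rewrite !sgnD1 // !scalerA -scaleNr (signC ij).
have -> : S :\ i :\ j = S :\ j :\ i by rewrite setDDl setUC -setDDl.
by congr (_ *: _); ring.
Qed.

Lemma wedge1K i f S : wedge1 i (wedge1 i f) S = 0.
Proof. by rewrite /wedge1 !inE eqxx /=; case: ifP; rewrite ?scaler0. Qed.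

Lemma contr1C i j f S : i != j ->
  contr1 i (contr1 j f) S = - contr1 j (contr1 i f) S.
Proof.
move=> ij; rewrite /contr1 !inE (eq_sym j i) (negPf ij) /=.
case: (boolP (i \in S)) => iS; case: (boolP (j \in S)) => jS;
  rewrite ?scaler0 ?oppr0 //=.
rewrite !sgnU1 // !scalerA -scaleNr (signC ij).
have -> : j |: (i |: S) = i |: (j |: S) by rewrite setUCA.
by congr (_ *: _); ring.
Qed.

Lemma contr1K i f S : contr1 i (contr1 i f) S = 0.
Proof. by rewrite /contr1 !inE eqxx /=; case: ifP; rewrite ?scaler0. Qed.

(** The Clifford relation. Summed against the [z i] it makes multiplication by [z j] null-homotopic,
    for [wedge z] and for [contr z]. *)
Lemma wedge1_contr1 i j f S :
  wedge1 i (contr1 j f) S + contr1 j (wedge1 i f) S = if i == j then f S else 0.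
Proof.
rewrite /wedge1 /contr1 !inE; case: eqVneq => [<-|ij].
  case: (boolP (j \in S)) => /= iS.
    by rewrite addr0 scalerA sgnD1 // ltnn mul1r sgnK setD1K // scale1r.
  by rewrite add0r scalerA sgnU1 // ltnn mul1r sgnK setU1K // scale1r.
case: (boolP (i \in S)) => iS /=; last first.
  by rewrite scaler0 add0r if_same.
case: (boolP (j \in S)) => jS; rewrite ?scaler0 ?addr0 //.
rewrite sgnD1 // sgnU1 // !scalerA.
have -> : j |: S :\ i = (j |: S) :\ i.
  by rewrite setDUl; congr setU; apply/setP => l; rewrite !inE;
     case: eqVneq => [->|]; rewrite ?andbF ?orbT //= ij.
rewrite -scalerDl (signC ij) (_ : _ + _ = 0) ?scale0r //; ring.
Qed.

(** The terms at (i, j) and (j, i) cancel; the diagonal is a separate hypothesis because [V] may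
    have 2-torsion. *)
Lemma antisym_sum (a : 'I_t -> 'I_t -> V) :
  (forall i j, i != j -> a i j = - a j i) -> (forall i, a i i = 0) ->
  \sum_i \sum_j a i j = 0.
Proof.
move=> aC aK.
have E i : \sum_j a i j = \sum_(j : 'I_t | (i < j)%N) a i j + \sum_(j : 'I_t | (j < i)%N) a i j.
  rewrite (bigID (fun j : 'I_t => (i < j)%N)) /=; congr (_ + _).
  rewrite (bigD1 i) /= ?ltnn // aK add0r; apply: eq_bigl => j.
  by rewrite -leqNgt ltn_neqAle -val_eqE andbC.
under eq_bigr do rewrite E.
rewrite big_split /= [X in _ + X](exchange_big_dep xpredT) //= -big_split /=.
apply: big1 => i _; rewrite -big_split /=; apply: big1 => j ij.
by rewrite aC ?addNr // -val_eqE /= neq_ltn ij.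
Qed.

Lemma wedge_wedge z f S : wedge z (wedge z f) S = 0.
Proof.
rewrite (_ : wedge z f = fun S => \sum_i z i *: wedge1 i f S); last first.
  by apply/funext => T; rewrite wedgeE.
rewrite wedgeE; under eq_bigr do rewrite wedge1_sum scaler_sumr.
apply: antisym_sum => [i j ij|i]; last by rewrite wedge1K !scaler0.
by rewrite wedge1C // !scalerN !scalerA mulrC.
Qed.

Lemma contr_contr z f S : contr z (contr z f) S = 0.
Proof.
rewrite (_ : contr z f = fun S => \sum_i z i *: contr1 i f S); last first.
  by apply/funext => T; rewrite contrE.
rewrite contrE; under eq_bigr do rewrite contr1_sum scaler_sumr.
apply: antisym_sum => [i j ij|i]; last by rewrite contr1K !scaler0.
by rewrite contr1C // !scalerN !scalerA mulrC.
Qed.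

Lemma wedge_contr1 z j f S :
  wedge z (contr1 j f) S + contr1 j (wedge z f) S = z j *: f S.
Proof.
rewrite (_ : wedge z f = fun S => \sum_i z i *: wedge1 i f S); last first.
  by apply/funext => T; rewrite wedgeE.
rewrite wedgeE contr1_sum -big_split /= (bigD1 j) //= -scalerDr wedge1_contr1 eqxx.
rewrite big1 ?addr0 // => i ij.
by rewrite -scalerDr wedge1_contr1 (negPf ij) scaler0.
Qed.

Lemma contr_wedge1 z j f S :
  contr z (wedge1 j f) S + wedge1 j (contr z f) S = z j *: f S.
Proof.
rewrite (_ : contr z f = fun S => \sum_i z i *: contr1 i f S); last first.
  by apply/funext => T; rewrite contrE.
rewrite contrE wedge1_sum -big_split /= (bigD1 j) //= -scalerDr addrC.
rewrite [contr1 _ _ _ + _]addrC wedge1_contr1 eqxx.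
rewrite big1 ?add0r // => i ij.
by rewrite -scalerDr addrC wedge1_contr1 eq_sym (negPf ij) scaler0.
Qed.

Lemma contr_contr1 z j f S : contr z (contr1 j f) S = - contr1 j (contr z f) S.
Proof.
rewrite (_ : contr z f = fun S => \sum_i z i *: contr1 i f S); last first.
  by apply/funext => T; rewrite contrE.
rewrite contrE contr1_sum -sumrN; apply: eq_bigr => i _.
have [<-|ij] := eqVneq i j; first by rewrite !contr1K scaler0 oppr0.
by rewrite contr1C // scalerN.
Qed.

Lemma wedge_lin z a f g S :
  wedge z (fun S => a *: f S + g S) S = a *: wedge z f S + wedge z g S.
Proof.
rewrite /wedge scaler_sumr -big_split /=; apply: eq_bigr => i _.
by rewrite !scalerDr !scalerA; congr (_ *: _ + _); ring.
Qed.

Lemma contr_lin z a f g S :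
  contr z (fun S => a *: f S + g S) S = a *: contr z f S + contr z g S.
Proof.
rewrite /contr scaler_sumr -big_split /=; apply: eq_bigr => i _.
by rewrite !scalerDr !scalerA; congr (_ *: _ + _); ring.
Qed.

Lemma wedgeD z f g S : wedge z (fun S => f S + g S) S = wedge z f S + wedge z g S.
Proof.
have := wedge_lin z 1 f g S; rewrite scale1r => <-; congr (wedge z _ S).
by apply/funext => T; rewrite scale1r.
Qed.

Lemma wedgeZ z a f S : wedge z (fun S => a *: f S) S = a *: wedge z f S.
Proof.
rewrite /wedge scaler_sumr; apply: eq_bigr => i _.
by rewrite !scalerA; congr (_ *: _); ring.
Qed.

Lemma wedgeB z f g S : wedge z (fun S => f S - g S) S = wedge z f S - wedge z g S.
Proof.
rewrite wedgeD; congr (_ + _); rewrite -scaleN1r -wedgeZ.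
by congr (wedge z _ S); apply/funext => T; rewrite scaleN1r.
Qed.

Lemma wedge0 z S : wedge z (fun=> 0) S = 0.
Proof. by rewrite /wedge big1 // => i _; rewrite !scaler0. Qed.

Lemma wedge_deg z f p S : (forall T, #|T|.+1 != p -> f T = 0) ->
  #|S| != p -> wedge z f S = 0.
Proof.
move=> hf hS; rewrite /wedge big1 // => i iS; rewrite hf ?scaler0 //.
by apply: contraNneq hS => <-; rewrite [in X in X == _](cardsD1 i) iS.
Qed.

Lemma wedge_closed (A : V -> Prop) z f S : submod A -> (forall T, A (f T)) ->
  A (wedge z f S).
Proof.
by move=> sA hf; apply: submod_sum => // i _; do 2!apply: submodZ => //.
Qed.

Lemma contr1_closed (A : V -> Prop) i f S : submod A -> (forall T, A (f T)) ->
  A (contr1 i f S).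
Proof.
move=> sA hf; rewrite /contr1; case: ifP => _; first exact: submod0.
exact: submodZ.
Qed.

End Exterior.

(** * Krull dimension *)

Section PrimeIdeals.
Variable R : comNzRingType.
Implicit Types (I J Q : R -> Prop) (C : R -> Prop) (x : R).
Local Notation ideal := (@submod R R^o).

Lemma idealM I a x : ideal I -> I x -> I (a * x).
Proof. by move=> iI; apply: (submodZ iI a). Qed.

(** An ideal maximal among those that contain [I] and avoid the multiplicative set [C] is prime. *)
Lemma exists_prime_avoiding I C : ideal I -> C 1 ->
  (forall a b, C a -> C b -> C (a * b)) -> (forall a, C a -> ~ I a) ->
  exists Q, [/\ ideal Q, (forall a b, Q (a * b) -> Q a \/ Q b),
                (forall a, I a -> Q a) & (forall a, C a -> ~ Q a)].
Proof.
move=> iI C1 CM CI.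
pose good (Q : set R) := [/\ ideal Q, (forall a, I a -> Q a) & forall a, C a -> ~ Q a].
pose P (Q : set R) := Q = set0 \/ good Q.
have [F PF totF|Q [PQ maxQ]] := @Zorn_bigcup R P.
  have [[X FX gX]|noX] := pselect (exists2 X, F X & good X); last first.
    left; apply/seteqP; split=> // a [X FX Xa].
    case: (PF _ FX) => [X0|gX]; first by rewrite -X0.
    by case: noX; exists X.
  have nz Y a : F Y -> Y a -> good Y.
    by move=> FY Ya; case: (PF _ FY) => // E; rewrite E in Ya.
  right; split.
  - split; first by exists X => //; case: gX => -[].
    move=> a u v [Y FY Yu] [Z FZ Zv].
    have [[_ hY] _ _] := nz _ _ FY Yu; have [[_ hZ] _ _] := nz _ _ FZ Zv.
    case: (totF _ _ FY FZ) => s.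
      by exists Z => //; apply: hZ => //; apply: s.
    by exists Y => //; apply: hY => //; apply: s.
  - by move=> a Ia; exists X => //; case: gX => _ + _; apply.
  - by move=> a Ca [Y FY Ya]; have [_ _ h] := nz _ _ FY Ya; apply: h Ya.
have gQ : good Q.
  case: PQ => // Q0; exfalso; apply: (maxQ I); last by right; split.
  by rewrite Q0; split=> [a []|h]; apply: (h 0); exact: submod0 iI.
have [iQ IQ CQ] := gQ; exists Q; split=> // a b Qab.
(* By maximality of [Q], the ideal [Q + (c)] meets [C]. *)
have ext c : ~ Q c -> exists q e, Q q /\ C (q + e * c).
  move=> nQc; apply: contrapT => nC.
  apply: (maxQ (fun d => exists q e, Q q /\ d = q + e * c)).
    split=> [d Qd|h]; first by exists d, 0; rewrite mul0r addr0.
    apply: nQc; apply: h; exists 0, 1; rewrite mul1r add0r; split=> //.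
    exact: submod0 iQ.
  right; split.
  - split; first by exists 0, 0; rewrite mul0r addr0; split=> //; exact: submod0 iQ.
    move=> r u v [q [e [Qq ->]]] [q' [e' [Qq' ->]]].
    exists (r * q + q'), (r * e + e'); split; first exact: iQ.2.
    have E : r * (q + e * c) + (q' + e' * c) = r * q + q' + (r * e + e') * c by ring.
    exact: E.
  - by move=> d Id; exists d, 0; rewrite mul0r addr0; split=> //; apply: IQ.
  - by move=> d Cd [q [e [Qq E]]]; apply: nC; exists q, e; rewrite -E.
apply: contrapT => /not_orP[nQa nQb].
have [q [e [Qq Cq]]] := ext _ nQa; have [q' [e' [Qq' Cq']]] := ext _ nQb.
apply: (CQ _ (CM _ _ Cq Cq')).
have -> : (q + e * a) * (q' + e' * b) =
  (q' + e' * b) * q + (e * a * q' + (e * e') * (a * b)) by ring.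
apply: (submodD iQ); first exact: idealM.
by apply: (submodD iQ); apply: idealM.
Qed.

End PrimeIdeals.

Section Dimension.
Variables (k : fieldType) (n : nat).
Local Notation R := {mpoly k[n]}.
Local Notation ideal := (@submod R R^o).
Implicit Types (I J : R -> Prop).

(** The bound dim R / J < m in natural numbers; [m = 0], where no prime contains [J], starts the
    induction on the dimension. *)
Definition dim_lt J (m : nat) : Prop := forall r, prime_chain J r -> (r < m)%N.

Lemma prime_expr (p : {pred R}) (x : R) l : idealr_closed p ->
  prime_idealr_closed p -> x ^+ l \in p -> x \in p.
Proof.
move=> [_ p1 _] pp; elim: l => [|l IHl]; first by rewrite expr0 (negPf p1).
by rewrite exprS => /pp/orP[//|/IHl].
Qed.

Lemma dim_lt_radical I J m : (forall x, I x -> exists l, J (x ^+ l)) ->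
  dim_lt I m -> dim_lt J m.
Proof.
move=> IJ dI r [p [hp sp]]; apply: dI; exists p; split=> // i ir.
have [ip pp Jp] := hp i ir; split=> // x /IJ[l /Jp]; exact: prime_expr.
Qed.

Lemma dim_lt0 J : ideal J -> dim_lt J 0 -> J 1.
Proof.
move=> iJ dJ; apply: contrapT => nJ.
have [|_ _ <- <-|_ <-|Q [iQ pQ JQ Q1]] := exists_prime_avoiding (C := eq 1) iJ => //.
  by rewrite mulr1.
suff /dJ : prime_chain J 0 by [].
exists (fun=> (fun x => `[< Q x >])); split=> // i _; split.
- split; first by apply/asboolP; exact: submod0 iQ.
    by apply/asboolP; apply: Q1.
  by move=> a u v /asboolP Qu /asboolP Qv; apply/asboolP; apply: iQ.2.
- by move=> u v /asboolP/pQ[] h; apply/orP; [left|right]; apply/asboolP.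
- by move=> x Jx; apply/asboolP; apply: JQ.
Qed.

(* The boundary ideal [(J : x^oo) + (x)] is contained in no minimal prime of
   [J], so every chain of primes above it can be extended downwards. *)
Lemma dim_lt_boundary J x m : ideal J -> dim_lt J m.+1 ->
  dim_lt (fun y => exists a b, y = a + x * b /\ exists c, J (a * x ^+ c)) m.
Proof.
move=> iJ dJ r [p [hp sp]]; rewrite -ltnS; apply: dJ.
have [ip pp Jp] := hp 0%N isT; have [p0 p1 pD] := ip.
have xp : x \in p 0%N.
  apply: Jp; exists 0, 1; rewrite add0r mulr1; split=> //; exists 0%N.
  by rewrite mul0r; exact: submod0 iJ.
(* A prime avoiding [C] lies inside [p 0] and misses [x], so it extends the chain downwards. [J]
   avoids [C]: if [a * x ^+ c] is in [J], then [a] is in the boundary ideal, hence in [p 0]. *)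
pose C (y : R) := exists a c, a \notin p 0%N /\ y = a * x ^+ c.
have [|||Q [iQ pQ JQ CQ]] := exists_prime_avoiding (C := C) iJ.
- by exists 1, 0%N; rewrite mulr1.
- move=> _ _ [a [c [ha ->]]] [a' [c' [ha' ->]]]; exists (a * a'), (c + c')%N.
  split; last by rewrite exprD; ring.
  by apply/negP => /pp; rewrite (negPf ha) (negPf ha').
- move=> _ [a [c [ha ->]]] Jac; move/negP: ha; apply; apply: Jp.
  by exists a, 0; rewrite mulr0 addr0; split=> //; exists c.
exists (fun i => if i is i'.+1 then p i' else (fun x => `[< Q x >])); split.
  move=> [_|i /hp[ipi ppi Jpi]]; split=> //.
  - split; first by apply/asboolP; exact: submod0 iQ.
      by apply/asboolP; apply: CQ; exists 1, 0%N; rewrite mulr1.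
    by move=> a u v /asboolP Qu /asboolP Qv; apply/asboolP; apply: iQ.2.
  - by move=> u v /asboolP/pQ[] h; apply/orP; [left|right]; apply/asboolP.
  - by move=> y Jy; apply/asboolP; apply: JQ.
  - move=> y Jy; apply: Jpi; exists y, 0; rewrite mulr0 addr0; split=> //.
    by exists 0%N; rewrite mulr1.
move=> [_|i /sp//]; split.
  move=> y /asboolP Qy; apply: contraT => hy.
  by case: (CQ y) => //; exists y, 0%N; rewrite mulr1.
exists x => //; apply/asboolP; apply: CQ; exists 1, 1%N.
by rewrite mul1r expr1.
Qed.

End Dimension.

(** * Vanishing of local cohomology above the dimension *)

Section Vanishing.
Import mathcomp.boot.finset.
Variables (k : fieldType) (n : nat).
Local Notation R := {mpoly k[n]}.
Local Notation ideal := (@submod R R^o).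

Definition var (i : 'I_n) : R := mpolyX k (mnm1 i).
Definition vpow (t : nat) (i : 'I_n) : R := var i ^+ t.

Section Module.
Variable V : lmodType R.
Implicit Types (f g : {set 'I_n} -> V) (A B C : V -> Prop) (S : {set 'I_n}).

(** The transition map from the Koszul cochains of the X_i^t to those of the X_i^(t+u); [push_wedge]
    says that it is a map of complexes. *)
Definition push u f S : V := varprod k S ^+ u *: f S.

Lemma push_wedge t u f S :
  varprod k S ^+ u *: wedge (vpow t) f S = wedge (vpow (t + u)) (push u f) S.
Proof.
rewrite /wedge scaler_sumr; apply: eq_bigr => i iS.
rewrite /push (varprodD1 _ iS) !scalerA; congr (_ *: _).
by rewrite /vpow exprD exprMn -/(var i); ring.
Qed.

(* The local cohomology in degree [p] of [B / A] vanishes: it is the colimit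
   over [t] of the Koszul cohomology of the powers [X_i ^ t]. *)
Definition ind_vanish p A B : Prop := forall t f,
  (forall S, #|S| != p -> f S = 0) -> (forall S, B (f S)) ->
  (forall S, A (wedge (vpow t) f S)) ->
  exists u g, [/\ forall S, #|S|.+1 != p -> g S = 0, forall S, B (g S) &
    forall S, A (push u f S - wedge (vpow (t + u)) g S)].

(** Exactness of H^p(B / A) -> H^p(C / A) -> H^p(C / B) in the middle. *)
Lemma ind_vanish_trans p A B C : submod A -> submod C ->
    (forall v, A v -> B v) -> (forall v, B v -> C v) ->
  ind_vanish p A B -> ind_vanish p B C -> ind_vanish p A C.
Proof.
move=> sA sC AB BC vAB vBC t f f0 fC fA.
have [u [g [g0 gC gB]]] := vBC t f f0 fC (fun S => AB _ (fA S)).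
pose a S := push u f S - wedge (vpow (t + u)) g S.
have [|S|u' [h [h0 hB hA]]] := vAB (t + u)%N a _ gB.
- by move=> S hS; rewrite /a /push f0 // scaler0 (wedge_deg _ g0) // subr0.
- rewrite wedgeB wedge_wedge subr0 -push_wedge; exact: submodZ.
exists (u + u')%N, (fun S => push u' g S + h S); split.
- by move=> S hS; rewrite /push g0 // h0 // scaler0 addr0.
- by move=> S; apply: submodD => //; [exact: submodZ | exact: BC].
move=> S; rewrite wedgeD addnA -push_wedge opprD addrA.
have := hA S; rewrite /push /a scalerBr /push scalerA exprD.
by rewrite [varprod k S ^+ u * _]mulrC.
Qed.

(** Put x = [var j], a nonzerodivisor on [B / A]. The vanishing of H^p of [B / (xB + A)] makes x
    injective on H^(p+1) of [B / A], where every class is killed by a power of x. The claim is an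
    induction on this power. *)
Lemma ind_vanish_regular p A B j : submod A -> submod B ->
    (forall v, A v -> B v) -> (forall b, B b -> A (var j *: b) -> A b) ->
  ind_vanish p (fun v => exists b a, [/\ B b, A a & v = var j *: b + a]) B ->
  ind_vanish p.+1 A B.
Proof.
move=> sA sB AB tf vx t f f0 fB fA.
suff claim c : forall t f, (forall S, #|S| != p.+1 -> f S = 0) ->
    (forall S, B (f S)) ->
    (exists g, [/\ forall S, #|S| != p -> g S = 0, forall S, B (g S) &
      forall S, A (var j ^+ c *: f S - wedge (vpow t) g S)]) ->
    exists u g, [/\ forall S, #|S|.+1 != p.+1 -> g S = 0, forall S, B (g S) &
      forall S, A (push u f S - wedge (vpow (t + u)) g S)].
  (* Contraction against e_j is a homotopy for multiplication by the entry [var j ^+ t], so the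
     power [t] kills the class. *)
  apply: (claim t t f f0 fB); exists (contr1 j f); split=> S.
  - move=> hS; rewrite /contr1; case: ifP => // jS.
    by rewrite f0 ?scaler0 // cardsU1 jS.
  - exact: contr1_closed.
  - by rewrite -[var j ^+ t *: _](wedge_contr1 (vpow t)) addrC addKr; apply: contr1_closed.
elim: c => [|c IHc] {fA f0 fB f t} t f f0 fB [g [g0 gB gA]].
  exists 0%N, g; split=> // S; rewrite addn0 /push expr0.
  by have := gA S; rewrite expr0.
have [|u [h [h0 hB hA]]] := vx t g g0 gB.
  move=> S; exists (var j ^+ c *: f S), (- (var j ^+ c.+1 *: f S - wedge (vpow t) g S)).
  split; [exact: submodZ | exact: submodN |].
  by rewrite scalerA -exprS opprB addrC subrK.
(* Modulo [A], [push u g] is a coboundary plus [var j *: w]. Applying [wedge] and cancelling [var j]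
   by [tf] shows that [var j ^+ c] already kills the class of [push u f], with [w] as witness. *)
have /choice[w hw] : forall S, exists b, [/\ B b, #|S| != p -> b = 0 &
    A (push u g S - wedge (vpow (t + u)) h S - var j *: b)].
  move=> S; have [hS|hS] := eqVneq #|S| p.
    have [b [a [Bb Aa E]]] := hA S; exists b; split=> //.
    by rewrite E [_ + a]addrC addrK.
  exists 0; split=> //; first exact: submod0.
  by rewrite /push g0 // (wedge_deg _ h0) // !scaler0 !subr0; apply: submod0.
have [S hS|S||u' [g' [g'0 g'B g'A]]] := IHc (t + u)%N (push u f).
- by rewrite /push f0 // scaler0.
- exact: submodZ.
- exists w; split=> S; [by case: (hw S) | by case: (hw S) |].
  apply: tf.
    apply: submodB => //; first by do 2!apply: submodZ => //.
    by apply: wedge_closed => // T; case: (hw T).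
  have hw3 T : A (push u g T - wedge (vpow (t + u)) h T - var j *: w T).
    by case: (hw T).
  have := wedge_closed (vpow (t + u)) S sA hw3.
  rewrite !wedgeB wedge_wedge subr0 wedgeZ -push_wedge => hD.
  have := submodD sA (submodZ sA (varprod k S ^+ u) (gA S)) hD.
  rewrite scalerBr addrA subrK [X in A (X - _)](_ : _ = var j *: (var j ^+ c *: push u f S)).
    by rewrite -scalerBr.
  by rewrite /push !scalerA; congr (_ *: _); rewrite exprS; ring.
exists (u + u')%N, g'; split=> // S; rewrite addnA.
by have := g'A S; rewrite /push scalerA -exprD [(u' + u)%N]addnC.
Qed.

(** In degree [p.+1] only nonempty [S] matter, and a variable of [S] has a power that sends [f S]
    into [A]: the cochain itself dies under a large enough [push]. *)
Lemma ind_vanish_torsion p A B : submod A -> submod B ->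
    (forall b, B b -> forall i, exists c, A (var i ^+ c *: b)) ->
  ind_vanish p.+1 A B.
Proof.
move=> sA sB tor t f f0 fB fA.
have /choice[c hc] : forall Si : {set 'I_n} * 'I_n, exists c,
    A (var Si.2 ^+ c *: f Si.1) by move=> Si; apply: tor.
exists (\sum_Si c Si)%N, (fun=> 0); split=> // S; first exact: submod0.
rewrite wedge0 subr0 /push.
have [->|[i iS]] := set_0Vmem S.
  by rewrite f0 ?scaler0 ?cards0 //; apply: submod0.
rewrite (varprodD1 _ iS) exprMn mulrC -scalerA; apply: submodZ => //.
rewrite (bigD1 (S, i)) //= addnC exprD -scalerA; apply: submodZ => //.
exact: (hc (S, i)).
Qed.

(** [tor l] is the part of [B] that is torsion modulo [A] for each variable in [l]. For all
    variables together [ind_vanish_torsion] applies; then the variables are dropped one by one. The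
    layer between [tor (i :: l)] and [tor l] has no X_i-torsion, and its quotient by X_i is killed
    by the boundary ideal of [J], so the induction hypothesis and [ind_vanish_regular] handle it. *)
Lemma dim_ind_vanish J A B m p : ideal J -> submod A -> submod B ->
    (forall v, A v -> B v) -> (forall a b, J a -> B b -> A (a *: b)) ->
  dim_lt J m -> (m <= p)%N -> ind_vanish p A B.
Proof.
elim: m J A B p => [|m IHm] J A B p iJ sA sB AB JBA dJ mp.
  move=> t f f0 fB fA; exists 0%N, (fun=> 0); split=> // S; first exact: submod0.
  rewrite wedge0 subr0 /push expr0; apply: JBA => //; exact: dim_lt0.
case: p mp => // p mp.
pose tor (l : seq 'I_n) b := B b /\ forall i, i \in l -> exists c, A (var i ^+ c *: b).
have tor_sub l : submod (tor l).
  split=> [|a v w [Bv tv] [Bw tw]]; split; first exact: submod0.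
  - by move=> i _; exists 0%N; rewrite scaler0; apply: submod0.
  - exact: sB.2.
  move=> i il; have [c hc] := tv i il; have [d hd] := tw i il.
  exists (c + d)%N; rewrite scalerDr; apply: submodD => //.
    have -> : var i ^+ (c + d) *: (a *: v) = (a * var i ^+ d) *: (var i ^+ c *: v).
      by rewrite !scalerA exprD; congr (_ *: _); ring.
    exact: submodZ.
  by rewrite exprD -scalerA; apply: submodZ.
have Ator l v : A v -> tor l v.
  by move=> Av; split=> [|i _]; [exact: AB | exists 0%N; rewrite expr0; apply: submodZ].
suff H l : ind_vanish p.+1 A (tor l) -> ind_vanish p.+1 A (tor [::]).
  have : ind_vanish p.+1 A (tor [::]).
    apply: (H (enum 'I_n)); apply: ind_vanish_torsion => // b [_ tb] i.
    by apply: tb; rewrite mem_enum.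
  rewrite (_ : tor [::] = B) //; apply/funext => v; apply/propext.
  by split=> [[]|Bv].
elim: l => // i l IHl vl; apply: IHl.
have sub v : tor (i :: l) v -> tor l v.
  by move=> [Bv tv]; split=> // i' hi'; apply: tv; rewrite inE hi' orbT.
apply: (ind_vanish_trans sA (tor_sub l) (Ator _) sub vl).
apply: (ind_vanish_regular (j := i)) => //.
  move=> b [Bb tb] [_ txb]; split=> // i'; rewrite inE => /orP[/eqP->|]; last exact: tb.
  have [c [d hd]] : exists c, exists d, A (var i ^+ d *: (var i ^+ c *: b)).
    by have [c hc] := txb i (mem_head _ _); exists 1%N, c; rewrite expr1.
  by exists (d + c)%N; rewrite exprD -scalerA.
pose E v := exists b a, [/\ tor l b, tor (i :: l) a & v = var i *: b + a].
have sE : submod E.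
  split=> [|c u v [b [a [hb ha ->]]] [b' [a' [hb' ha' ->]]]].
    by exists 0, 0; rewrite scaler0 addr0; split=> //; apply: submod0.
  exists (c *: b + b'), (c *: a + a'); split; [exact: (tor_sub _).2..|].
  rewrite !scalerDr !scalerA mulrC -!addrA; congr (_ + _).
  by rewrite addrCA.
apply: (IHm _ _ _ _ _ sE _ _ _ (dim_lt_boundary (x := var i) iJ dJ)) => //.
- split=> [|c u v [a [b [-> [d hd]]]] [a' [b' [-> [d' hd']]]]].
    exists 0, 0; rewrite mulr0 addr0; split=> //; exists 0%N; rewrite mul0r.
    exact: submod0 iJ.
  exists (c * a + a'), (c * b + b'); split.
    have E' : c * (a + var i * b) + (a' + var i * b') =
      c * a + a' + var i * (c * b + b') by ring.
    exact: E'.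
  exists (d + d')%N.
  have -> : (c * a + a') * var i ^+ (d + d') =
    (c * var i ^+ d') * (a * var i ^+ d) + var i ^+ d * (a' * var i ^+ d').
    by rewrite exprD; ring.
  by apply: (submodD iJ); apply: idealM.
- move=> v [b [a [hb ha ->]]]; apply: submodD => //; last exact: sub.
  exact: submodZ.
(* As [a * var i ^+ d] lies in [J], the vector [a *: v] is also X_i-torsion modulo [A]. *)
move=> c v [a [b [-> [d hd]]]] tv; exists (b *: v), (a *: v); split.
- exact: submodZ.
- split=> [|i']; first by apply: submodZ => //; case: tv.
  rewrite inE => /orP[/eqP->|il].
    exists d; rewrite scalerA mulrC; apply: JBA => //; by case: tv.
  have [e he] := tv.2 i' il; exists e.
  by rewrite scalerA mulrC -scalerA; apply: submodZ.
by rewrite scalerDl scalerA addrC.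
Qed.
End Module.
End Vanishing.

(** * Noetherianity of polynomial rings *)

Section Span.
Variables (R : comNzRingType) (V : lmodType R).
Implicit Types (l : seq V) (v w : V) (A : V -> Prop).

Fixpoint lspan l v : Prop :=
  if l is g :: l' then exists a, lspan l' (v - a *: g) else v = 0.

Lemma lspan_submod l : submod (lspan l).
Proof.
elim: l => [|g l IHl]; first by split=> //= a u v -> ->; rewrite scaler0 addr0.
split=> [|a u v [b hb] [c hc]].
  by exists 0; rewrite scale0r subr0; apply: submod0.
exists (a * b + c); rewrite scalerDl opprD addrACA -scalerA -scalerBr.
exact: IHl.2.
Qed.

Lemma lspan_cons g l v : lspan l v -> lspan (g :: l) v.
Proof. by move=> hv; exists 0; rewrite scale0r subr0. Qed.

Lemma lspan_mem l g : g \in l -> lspan l g.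
Proof.
elim: l => // h l IHl; rewrite inE => /predU1P[->|/IHl]; last exact: lspan_cons.
by exists 1; rewrite scale1r subrr; apply: submod0 (lspan_submod l).
Qed.

Lemma lspan_sub l A v : submod A -> (forall g, g \in l -> A g) -> lspan l v -> A v.
Proof.
move=> sA; elim: l v => [|g l IHl] v /= lA; first by move=> ->; apply: submod0.
move=> [a /IHl hv]; rewrite -[v](subrK (a *: g)); apply: submodD => //.
  by apply: hv => h hl; apply: lA; rewrite inE hl orbT.
by apply: submodZ => //; apply: lA; rewrite mem_head.
Qed.

Lemma lspan_catl l l' v : lspan l v -> lspan (l ++ l') v.
Proof.
apply: lspan_sub; first exact: lspan_submod.
by move=> g hg; apply: lspan_mem; rewrite mem_cat hg.
Qed.

Lemma lspan_catr l l' v : lspan l' v -> lspan (l ++ l') v.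
Proof.
apply: lspan_sub; first exact: lspan_submod.
by move=> g hg; apply: lspan_mem; rewrite mem_cat hg orbT.
Qed.

Definition spanned_by_finite A : Prop :=
  exists l, (forall g, g \in l -> A g) /\ forall v, A v -> lspan l v.

End Span.

(** The coefficients at [g] of elements of [A] form an ideal [I]. Lifts to [A] of generators of [I],
    together with generators of the part of [A] in the span of [l], generate [A]. *)
Lemma noetherian_module (R : comNzRingType) (V : lmodType R) (l : seq V)
    (A : V -> Prop) :
  (forall I : R^o -> Prop, submod I -> spanned_by_finite I) ->
  submod A -> (forall v, A v -> lspan l v) -> spanned_by_finite A.
Proof.
move=> noeR; elim: l A => [|g l IHl] A sA Al.
  by exists [::]; split=> // v /Al.
have sl := lspan_submod l.
pose I (a : R^o) := exists w, lspan l w /\ A (a *: g + w).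
have [|al [Ial alP]] := noeR I.
  split=> [|c a b [w [hw Aw]] [w' [hw' Aw']]].
    by exists 0; rewrite scale0r addr0; split; apply: submod0.
  exists (c *: w + w'); split; first exact: sl.2.
  rewrite (_ : _ + _ = c *: (a *: g + w) + (b *: g + w')); first exact: sA.2.
  by rewrite scalerDl -scalerA scalerDr addrACA.
have [ul [ulA ulP]] : exists ul, (forall u, u \in ul -> A u) /\
    forall a, lspan al a -> exists2 u, lspan ul u & lspan l (u - a *: g).
  elim: al Ial {alP} => [|a al IHal] Ial.
    exists [::]; split=> // a ->; exists 0 => //.
    by rewrite scale0r subrr; apply: submod0.
  have [|ul [ulA ulP]] := IHal.
    by move=> b hb; apply: Ial; rewrite inE hb orbT.
  have [w [hw Aw]] := Ial a (mem_head _ _).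
  exists (a *: g + w :: ul); split.
    by move=> u; rewrite inE => /predU1P[->|/ulA].
  move=> b [c /ulP[u hu hl]]; exists (u + c *: (a *: g + w)).
    by exists c; rewrite addrK.
  rewrite (_ : _ - _ = u - (b - c *: a) *: g + c *: w).
    by apply: submodD => //; apply: submodZ.
  by rewrite scalerBl opprB scalerDr -scalerA -!addrA; congr (_ + _);
    rewrite addrCA [c *: w + _]addrC addrA.
have [|v [_ hv] //|l' [l'A l'P]] := IHl (fun v => A v /\ lspan l v).
  split=> [|a u v [Au lu] [Av lv]]; first by split; apply: submod0.
  by split; [apply: sA.2 | apply: sl.2].
exists (ul ++ l'); split=> [u|v Av].
  by rewrite mem_cat => /orP[/ulA|/l'A[]].
have [a ha] := Al v Av.
have [|u hu hl] := ulP a.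
  by apply: alP; exists (v - a *: g); split=> //; rewrite addrC subrK.
rewrite -[v](subrK u); apply: (submodD (lspan_submod _)).
  apply/lspan_catr/l'P; split.
    apply: submodB => //; apply: (lspan_sub sA ulA hu).
  rewrite (_ : v - u = (v - a *: g) - (u - a *: g)); first exact: submodB.
  by rewrite opprB addrA subrK.
exact: lspan_catl.
Qed.

(** * Dickson's lemma and the Hilbert basis theorem *)

Lemma nondecreasing_subseq (w : nat -> nat) : exists phi : nat -> nat,
  (forall i, (phi i < phi i.+1)%N) /\ {homo w \o phi : i j / (i <= j)%N}.
Proof.
(* [mu m] is a place where the tail of [w] from [m] on attains its minimum; [phi] iterates [mu]. *)
have /choice[mu hmu] : forall m, exists i, (m <= i)%N /\
    forall j, (m <= j)%N -> (w i <= w j)%N.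
  move=> m.
  have [x [i [mi xi]] hx] : exists2 x, (exists i, (m <= i)%N /\ w i = x) &
      forall i, (m <= i)%N -> (x <= w i)%N.
    have exP : exists x, `[< exists i, (m <= i)%N /\ w i = x >].
      by exists (w m); apply/asboolP; exists m.
    case: (ex_minnP exP) => x /asboolP hx xmin; exists x => // i mi.
    by apply: xmin; apply/asboolP; exists i.
  by exists i; split=> // j mj; rewrite xi; apply: hx.
pose phi := fix phi i := if i is i'.+1 then mu (phi i').+1 else mu 0%N.
have phi_lt i : (phi i < phi i.+1)%N by case: (hmu (phi i).+1).
exists phi; split=> // ; apply: homo_leq => //; first exact: leq_trans.
move=> i /=; case: i => [|i] /=; first by apply: (hmu 0%N).2.
apply: (hmu (phi i).+1).2; exact: ltn_trans (phi_lt i) (phi_lt i.+1).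
Qed.

(** The sequence is thinned out once per coordinate until all coordinates are nondecreasing. *)
Lemma dickson n (u : nat -> multinom n) :
  exists i j, (i < j)%N /\ forall c, (u i c <= u j c)%N.
Proof.
have [phi [phi_lt phiP]] : exists phi : nat -> nat,
    (forall i, (phi i < phi i.+1)%N) /\ forall c, c \in enum 'I_n ->
    {homo (fun i => u (phi i) c) : i j / (i <= j)%N}.
  elim: (enum 'I_n) => [|c l [phi [phi_lt phiP]]]; first by exists id.
  have [psi [psi_lt psiP]] := nondecreasing_subseq (fun i => u (phi i) c).
  have mono f : (forall i, f i < f i.+1)%N -> {homo f : i j / (i < j)%N}.
    by move=> hf; apply: homo_ltn => //; apply: ltn_trans.
  exists (phi \o psi); split=> [i|c']; first exact: (mono phi).
  rewrite inE => /predU1P[->|c'l] i j ij; first exact: psiP.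
  apply: phiP => //; move: ij; rewrite leq_eqVlt => /predU1P[->//|ij].
  exact/ltnW/mono.
exists (phi 0%N), (phi 1%N); split=> // c; apply: phiP => //.
by rewrite mem_enum.
Qed.

(** If no finite list spans [I], every list in [I] can be followed by a nonzero element whose
    leading monomial is divisible by none of theirs, since otherwise division would reduce all of
    [I] to 0. Iterating this contradicts [dickson]. *)
Lemma hilbert_basis (k : fieldType) n (I : {mpoly k[n]}^o -> Prop) :
  submod I -> spanned_by_finite I.
Proof.
move=> iI; apply: contrapT => nfg.
have /choice[next hnext] : forall l : seq {mpoly k[n]}^o, exists p,
    (forall q, q \in l -> I q) -> [/\ I p, p != 0 & forall q, q \in l ->
      q != 0 -> ~~ lem (mlead q) (mlead p)].
  move=> l; have [lI|nlI] := pselect (forall q, q \in l -> I q); last by exists 0.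
  apply: contrapT => hl; apply: nfg; exists l; split=> // p.
  elim/mleadrect: p => p IHp Ip.
  have [->|p0] := eqVneq p 0; first exact: submod0 (lspan_submod l).
  have [q [ql q0 qp]] : exists q, [/\ q \in l, q != 0 & lem (mlead q) (mlead p)].
    apply: contrapT => nq; apply: hl; exists p => _; split=> // q ql q0.
    by apply/negP => qp; apply: nq; exists q.
  pose a : {mpoly k[n]} := (mcoeff (mlead p) p / mcoeff (mlead q) q) *:
    mpolyX k (mnm_sub (mlead p) (mlead q)).
  have lq : mcoeff (mlead q) q != 0 by rewrite mleadc_eq0.
  have lp : mcoeff (mlead p) p != 0 by rewrite mleadc_eq0.
  have la : mlead a = (mnm_sub (mlead p) (mlead q)).
    rewrite mleadZ_proper mleadXm // mcoeffX eqxx mulr1.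
    by rewrite mulf_neq0 // invr_eq0.
  have E : mnm_add (mlead a) (mlead q) = mlead p by rewrite la submK.
  have ca : mcoeff (mlead p) (a * q) = mcoeff (mlead p) p.
    by rewrite -{1}E mleadcM la mcoeffZ mcoeffX eqxx mulr1 divfK.
  rewrite -[p](subrK (a * q)); apply: (submodD (lspan_submod l)); last first.
    by apply: (submodZ (lspan_submod l) a); apply: lspan_mem.
  have [->|pa0] := eqVneq (p - a * q) 0; first exact: submod0 (lspan_submod l).
  apply: IHp; last first.
    by apply: (submodB iI) => //; apply: (submodZ iI a); apply: lI.
  rewrite lt_neqAle; apply/andP; split.
    apply: contraNneq pa0 => E2.
    by rewrite -mleadc_eq0 E2 mcoeffB ca subrr.
  apply: le_trans (mleadB_le _ _) _; rewrite leUx lexx /=.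
  by rewrite -E; apply: mleadM_le.
pose L := fix L i := if i is i'.+1 then next (L i') :: L i' else [::].
have LI i q : q \in L i -> I q.
  elim: i q => // i IHi q; rewrite inE => /predU1P[->|]; last exact: IHi.
  by case: (hnext (L i) IHi).
have Lmem i j : (i < j)%N -> next (L i) \in L j.
  elim: j => // j IHj; rewrite ltnS leq_eqVlt => /predU1P[->|/IHj] /=.
    exact: mem_head.
  by rewrite inE orbC => ->.
have [i [j [ij uij]]] := dickson (fun i => mlead (next (L i))).
have [_ _ /(_ (next (L i)))] := hnext (L j) (LI j).
have [_ ni _] := hnext (L i) (LI i).
by move=> /(_ (Lmem i j ij) ni)/negP; apply; apply/mnm_lepP.
Qed.

(** * Rigidity of Koszul homology *)

Section DetTrick.
Variables (R : comNzRingType) (z : R).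
Implicit Types (a c : R).

Definition power_mod a c := exists m r, c = a ^+ m + z * r.

Lemma power_mod_refl a : power_mod a a.
Proof. by exists 1%N, 0; rewrite mulr0 addr0 expr1. Qed.

Lemma power_mod1 a : power_mod a 1.
Proof. by exists 0%N, 0; rewrite mulr0 addr0. Qed.

Lemma power_modD a c r : power_mod a c -> power_mod a (c + z * r).
Proof. by case=> [m [s ->]]; exists m, (s + r); rewrite mulrDr addrA. Qed.

Lemma power_modM a c c' : power_mod a c -> power_mod a c' -> power_mod a (c * c').
Proof.
case=> [m [s ->]] [m' [s' ->]]; exists (m + m')%N, (s * (a ^+ m' + z * s') + a ^+ m * s').
by rewrite exprD; ring.
Qed.

Lemma power_modX a c l : power_mod a c -> power_mod a (c ^+ l).
Proof.
move=> ac; elim: l => [|l IHl]; first exact: power_mod1.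
by rewrite exprS; apply: power_modM.
Qed.

Lemma power_mod_trans a (b : R) c : power_mod a b -> power_mod b c -> power_mod a c.
Proof. by move=> ab [m [r ->]]; apply/power_modD/power_modX. Qed.

(* The determinant trick: if [a] maps the span of [l] into [z] times itself
   modulo [B], then so does some [c] congruent to a power of [a] map it into
   [B]; the generators are eliminated one by one. *)
Lemma power_mod_kill (V : lmodType R) (B : V -> Prop) (l : seq V) a :
  submod B ->
  (forall g, g \in l -> exists w b, [/\ lspan l w, B b & a *: g = z *: w + b]) ->
  exists2 c, power_mod a c & forall v, lspan l v -> B (c *: v).
Proof.
move=> sB; elim: l a => [|g l IHl] a hl.
  exists 1; first exact: power_mod1.
  by move=> v ->; rewrite scaler0; apply: submod0.
have sl := lspan_submod l.
have [w [b [[c hw] Bb E]]] := hl g (mem_head _ _).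
(* The coefficient [c] of [g] in [w] is absorbed into the multiplier, so that [c1 *: g] no longer
   refers to [g]. *)
pose c1 := a + z * - c.
have [w' [lw' E1]] : exists w', lspan l w' /\ c1 *: g = z *: w' + b.
  exists (w - c *: g); split=> //.
  by rewrite scalerDl E scalerBr !scalerA mulrN scaleNr addrAC.
have ac1 : power_mod a c1 by apply/power_modD/power_mod_refl.
(* The relation of another generator [h] may involve [g]; multiplied by [c1], it has [c1 *: g]
   replaced by [z *: w' + b]. *)
have [h hh|c' ac' hc'] := IHl (c1 * a).
  have [wh [bh [[e hwh] Bbh Eh]]] := hl h (mem_behead (s := g :: l) hh).
  exists ((e * z) *: w' + c1 *: (wh - e *: g)), ((z * e) *: b + c1 *: bh); split.
  - by apply: (submodD sl); apply: submodZ.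
  - by apply: submodD => //; apply: submodZ.
  rewrite -scalerA Eh -{1}[wh](subrK (e *: g)); move: (wh - _) => wl.
  transitivity ((z * e) *: (c1 *: g) + (z * c1) *: wl + c1 *: bh).
    rewrite !scalerDr !scalerA [X in X + _ *: bh]addrC.
    by congr (_ *: _ + _ *: _ + _); ring.
  rewrite E1 !scalerDr !scalerA mulrA -!addrA; congr (_ + _).
  exact: addrCA.
exists (c' * c1).
  apply: power_modM => //; apply: power_mod_trans ac'.
  by apply: power_modM => //; apply: power_mod_refl.
move=> v [e hv]; rewrite -[v](subrK (e *: g)) scalerDr; apply: submodD => //.
  by rewrite mulrC -scalerA; apply: submodZ => //; apply: hc'.
rewrite (_ : (c' * c1) *: (e *: g) = (e * z) *: (c' *: w') + (e * c') *: b).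
  by apply: submodD => //; apply: submodZ => //; apply: hc'.
transitivity ((e * c') *: (c1 *: g)); first by rewrite !scalerA; congr (_ *: _); ring.
by rewrite E1 scalerDr !scalerA; congr (_ *: _ + _); ring.
Qed.
End DetTrick.

Section Rigidity.
Import mathcomp.boot.finset.
Variables (R : comNzRingType) (s : nat) (M : lmodType R) (z : 'I_s -> R).
Local Notation V := ({set 'I_s} -> M).
Implicit Types (f g h : V) (G T : {set 'I_s}) (q : nat).

(* The chains of degree [q] of the Koszul complex of the subfamily [z_i],
   [i] in [G]. *)
Definition kchain q G f : Prop :=
  forall T, ~~ ((#|T| == q) && (T \subset G)) -> f T = 0.
Definition kcycle q G f : Prop := kchain q G f /\ contr z f = 0.
Definition kbound q G f : Prop := exists2 g, kchain q.+1 G g & f = contr z g.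

Lemma contrD f g : contr z (f + g) = contr z f + contr z g.
Proof.
apply/funext => T; have H := contr_lin z 1 f g T; rewrite scale1r in H.
by apply: etrans H; congr (contr z _ T); apply/funext => S; rewrite !fctE scale1r.
Qed.

Lemma contr0 : contr z (0 : V) = 0.
Proof. by apply: (addrI (contr z 0)); rewrite -contrD !addr0. Qed.

Lemma contrZ a f : contr z (a *: f) = a *: contr z f.
Proof.
apply/funext => T; have H := contr_lin z a f 0 T.
rewrite contr0 addr0 in H; apply: etrans H.
by congr (contr z _ T); apply/funext => S; rewrite !fctE addr0.
Qed.

Lemma contrN f : contr z (- f) = - contr z f.
Proof. by rewrite -scaleN1r contrZ scaleN1r. Qed.

Lemma contrK f : contr z (contr z f) = 0.
Proof. by apply/funext => T; rewrite contr_contr. Qed.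

Lemma kchain_submod q G : submod (kchain q G).
Proof.
split=> [T _ //|a f g hf hg T hT].
by rewrite !fctE hf // hg // scaler0 addr0.
Qed.

Lemma kcycle_submod q G : submod (kcycle q G).
Proof.
split=> [|a f g [hf zf] [hg zg]].
  by split; [exact: submod0 (kchain_submod _ _) | exact: contr0].
split; first exact: (kchain_submod _ _).2.
by rewrite contrD contrZ zf zg scaler0 addr0.
Qed.

Lemma kbound_submod q G : submod (kbound q G).
Proof.
split=> [|a f g [f' hf ->] [g' hg ->]].
  by exists 0; [exact: submod0 (kchain_submod _ _) | rewrite contr0].
exists (a *: f' + g'); first exact: (kchain_submod _ _).2.
by rewrite contrD contrZ.
Qed.

Lemma kchain_contr q G f : kchain q.+1 G f -> kchain q G (contr z f).
Proof.
move=> hf T hT; rewrite /contr big1 // => i iT; rewrite hf ?scaler0 //.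
by apply: contra hT; rewrite cardsU1 iT eqSS subUset => /andP[-> /andP[_ ->]].
Qed.

Lemma kbound_cycle q G f : kbound q G f -> kcycle q G f.
Proof. by move=> [g hg ->]; split; [exact: kchain_contr | exact: contrK]. Qed.

Lemma kchain_sub q G G' f : G \subset G' -> kchain q G f -> kchain q G' f.
Proof.
move=> GG hf T hT; apply: hf; apply: contra hT => /andP[-> h] /=.
exact: fintype.subset_trans GG.
Qed.

Lemma kchain_wedge1 q G G' j f : G \subset G' -> j \in G' ->
  kchain q G f -> kchain q.+1 G' (wedge1 j f).
Proof.
move=> GG jG hf T hT; rewrite /wedge1; case: ifP => // jT.
rewrite hf ?scaler0 //; apply: contra hT => /andP[/eqP <- h].
rewrite (cardsD1 j) jT add1n eqxx /= -(setD1K jT) subUset sub1set jG /=.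
exact: fintype.subset_trans GG.
Qed.

Lemma kchain_contr1 q G j f :
  kchain q.+1 G f -> kchain q (G :\ j) (contr1 j f).
Proof.
move=> hf T hT; rewrite /contr1; case: ifP => // /negbT jT.
rewrite hf ?scaler0 //; apply: contra hT; rewrite cardsU1 jT eqSS.
by rewrite subUset subsetD1 => /andP[-> /andP[_ ->]].
Qed.

Lemma contr1_notin q G j f : j \notin G -> kchain q G f -> contr1 j f = 0.
Proof.
move=> jG hf; apply/funext => T; rewrite /contr1; case: ifP => // jT.
by rewrite hf ?scaler0 // subUset sub1set (negPf jG) andbF.
Qed.

Lemma wedge1_0 j : wedge1 j (0 : V) = 0.
Proof. by apply/funext => T; rewrite /wedge1 scaler0 if_same. Qed.

Lemma contr1_0 j : contr1 j (0 : V) = 0.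
Proof. by apply/funext => T; rewrite /contr1 scaler0 if_same. Qed.

Lemma contr1Z j a f : contr1 j (a *: f) = a *: contr1 j f.
Proof.
apply/funext => T; rewrite /contr1 !fctE.
by case: ifP; rewrite ?scaler0 // !scalerA mulrC.
Qed.

Lemma contr1D j f g : contr1 j (f + g) = contr1 j f + contr1 j g.
Proof.
by apply/funext => T; rewrite /contr1 !fctE; case: ifP; rewrite ?addr0 // scalerDr.
Qed.

Lemma koszul_split j f : f = wedge1 j (contr1 j f) + contr1 j (wedge1 j f).
Proof. by apply/funext => T; rewrite !fctE wedge1_contr1 eqxx. Qed.

Lemma koszul_homotopy j f : contr z (wedge1 j f) = z j *: f - wedge1 j (contr z f).
Proof. by apply/funext => T; rewrite !fctE -contr_wedge1 addrK. Qed.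

Lemma koszul_contr1 j f : contr z (contr1 j f) = - contr1 j (contr z f).
Proof. by apply/funext => T; rewrite contr_contr1. Qed.

Lemma kchain_setD1 q G j f : kchain q G f -> contr1 j f = 0 -> kchain q (G :\ j) f.
Proof.
move=> hf cf T hT; have [jT|jT] := boolP (j \in T); last first.
  by apply: hf; apply: contra hT => /andP[-> h]; rewrite subsetD1 h jT.
by rewrite (koszul_split j f) cf wedge1_0 add0r /contr1 jT.
Qed.

Lemma kbound_entry q G j f : j \in G -> kcycle q G f -> kbound q G (z j *: f).
Proof.
move=> jG [hf zf]; exists (wedge1 j f); first exact: kchain_wedge1 hf.
by rewrite koszul_homotopy zf wedge1_0 subr0.
Qed.

(** The kernel of H_1(G \ j) -> H_1(G) is z_j H_1(G \ j): the boundary of [g] is [z j] times the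
    e_j-part of [g], up to the boundary of the rest. *)
Lemma kcycle1_entry G j f a : j \in G -> kcycle 1 (G :\ j) f ->
  kbound 1 G (a *: f) ->
  exists w b, [/\ kcycle 1 (G :\ j) w, kbound 1 (G :\ j) b & a *: f = z j *: w + b].
Proof.
move=> jG [hf zf] [g hg E]; have jG' : j \notin G :\ j by rewrite setD11.
have zw : contr z (contr1 j g) = 0.
  by rewrite koszul_contr1 -E contr1Z (contr1_notin jG' hf) scaler0 oppr0.
exists (contr1 j g), (contr z (contr1 j (wedge1 j g))); split.
- by split=> //; apply: kchain_contr1.
- exists (contr1 j (wedge1 j g)) => //.
  by apply: kchain_contr1; apply: kchain_wedge1 hg.
by rewrite E {1}(koszul_split j g) contrD koszul_homotopy zw wedge1_0 subr0.
Qed.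

(** In H_(q+2)(G \ j) -> H_(q+2)(G) -> H_(q+1)(G \ j) both ends are killed by [c], so [c * c] kills
    the middle. The degree is at least 2 to keep the right end off H_0. *)
Lemma kbound_extend q G j f c : j \in G ->
  (forall q f, (0 < q)%N -> kcycle q (G :\ j) f -> kbound q (G :\ j) (c *: f)) ->
  kcycle q.+2 G f -> kbound q.+2 G ((c * c) *: f).
Proof.
move=> jG hc [hf zf]; have jG' : j \notin G :\ j by rewrite setD11.
have [|h hh E] := hc q.+1 (contr1 j f) isT.
  split; first exact: kchain_contr1.
  by rewrite koszul_contr1 zf contr1_0 oppr0.
have hw : kchain q.+3 G (wedge1 j h).
  by apply: kchain_wedge1 hh => //; apply: subD1set.
pose f' := c *: f + contr z (wedge1 j h).
have [||h' hh' E'] := hc q.+2 f' => //.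
  split; last by rewrite contrD contrZ zf contrK scaler0 addr0.
  apply: kchain_setD1.
    apply: (submodD (kchain_submod _ _)); last exact: kchain_contr.
    exact: (submodZ (kchain_submod _ _)).
  have hjh : contr1 j (wedge1 j h) = h.
    by rewrite [RHS](koszul_split j) (contr1_notin jG' hh) wedge1_0 add0r.
  by rewrite contr1D contr1Z E -[contr1 j (contr z _)]opprK -koszul_contr1 hjh subrr.
exists (h' - c *: wedge1 j h).
  apply: (submodB (kchain_submod _ _)); first exact: kchain_sub (subD1set _ _) hh'.
  exact: (submodZ (kchain_submod _ _)).
rewrite contrD contrN contrZ -E' /f' scalerDr addrK scalerA //.
Qed.

Hypothesis noeV : forall A : V -> Prop, submod A -> spanned_by_finite A.

(** By [kcycle1_entry], [a] maps H_1(G \ j) into z_j H_1(G \ j), so the determinant trick gives a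
    [c], congruent to a power of [a] modulo z_j, that kills H_1(G \ j). By induction on the cardinal
    of [G] and [kbound_extend], a power of [c] kills H_q(G) for q > 1. As z_j kills H_q(G), the
    congruent power of [a] kills it too. *)
Lemma koszul_rigidity G a :
  (forall f, kcycle 1 G f -> kbound 1 G (a *: f)) ->
  exists l, forall q f, (0 < q)%N -> kcycle q G f -> kbound q G (a ^+ l *: f).
Proof.
move: {2}#|G| (erefl #|G|) => m; elim: m G a => [|m IHm] G a Gm H1.
  exists 0%N => q f q0 [hf _]; exists 0; first exact: submod0 (kchain_submod _ _).
  rewrite contr0 expr0 scale1r; apply/funext => T; apply: hf.
  move: Gm => /cards0_eq ->; rewrite subset0; apply/negP => /andP[/eqP E /eqP T0].
  by rewrite T0 cards0 in E; rewrite -E in q0.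
have [j jG] : exists j, j \in G by apply/set0Pn; rewrite -cards_eq0 Gm.
have Gm' : #|G :\ j| = m by move: Gm; rewrite (cardsD1 j) jG => -[].
have up q f : kbound q (G :\ j) f -> kbound q G f.
  by move=> [g hg ->]; exists g => //; apply: kchain_sub hg; apply: subD1set.
have [l [lZ lP]] := noeV (kcycle_submod 1 (G :\ j)).
have [g gl|c ac hc] := @power_mod_kill _ (z j) _ (kbound 1 (G :\ j)) l a (kbound_submod _ _).
  have zg := lZ g gl.
  have [|w [b [hw hb E]]] := kcycle1_entry jG zg (a := a).
    by apply: H1; case: zg => hg zg; split=> //; apply: kchain_sub hg; apply: subD1set.
  by exists w, b; split=> //; apply: lP.
have [l' hl'] := IHm (G :\ j) c Gm' (fun f hf => hc f (lP f hf)).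
have [m' [r E]] : power_mod (z j) a (c ^+ l' * c ^+ l').
  by apply: power_modM; apply: power_modX.
(* The successor leaves at least one factor [a] for degree 1, as [m'] may be 0. *)
exists m'.+1 => -[|[|q]] f // _ zf.
  by rewrite exprSr -scalerA; apply: (submodZ (kbound_submod _ _)); apply: H1.
rewrite exprS -scalerA; apply: (submodZ (kbound_submod _ _)).
rewrite -[a ^+ m'](addrK (z j * r)) -E scalerBl; apply: (submodB (kbound_submod _ _)).
- exact: (kbound_extend jG hl').
by rewrite mulrC -scalerA; apply: (submodZ (kbound_submod _ _)); apply: kbound_entry.
Qed.

End Rigidity.

(** * Lifting classes to the total complex *)

Section Zigzag.
Import mathcomp.boot.finset.
Variables (k : fieldType) (n s : nat).
Local Notation R := {mpoly k[n]}.
Variables (M : lmodType R) (z : 'I_s -> R).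
Local Notation V := ({set 'I_s} -> M).
Local Notation chain q := (@kchain R s M q [set: 'I_s]).
Local Notation cycle q := (@kcycle R s M z q [set: 'I_s]).
Local Notation bound q := (@kbound R s M z q [set: 'I_s]).
Implicit Types (c f : {set 'I_n} -> V) (S : {set 'I_n}) (y : 'I_n -> R).

Lemma wedge_eq0 y c S : (forall i, i \in S -> c (S :\ i) = 0) -> wedge y c S = 0.
Proof. by move=> h; rewrite /wedge big1 // => i /h ->; rewrite !scaler0. Qed.

Lemma contr_wedge y c S :
  contr z (wedge y c S) = wedge y (fun S => contr z (c S)) S.
Proof.
rewrite /wedge (big_morph (contr z) (contrD z) (contr0 M z)).
by apply: eq_bigr => i _; rewrite !contrZ.
Qed.

Lemma cardsD1_eq S i : i \in S -> #|S| = #|S :\ i|.+1.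
Proof. by move=> iS; rewrite (cardsD1 i) iS. Qed.

Lemma kchain0_contr (v : V) : chain 0 v -> contr z v = 0.
Proof.
move=> hv; apply/funext => T; rewrite /contr big1 // => i iT.
by rewrite hv ?scaler0 // cardsU1 iT.
Qed.

Lemma kchain_large q (v : V) : (s < q)%N -> chain q v -> v = 0.
Proof.
move=> sq hv; apply/funext => T; apply: hv; apply/negP => /andP[/eqP E _].
by have := max_card (mem T); rewrite card_ord E leqNgt sq.
Qed.

(* If [H^(i+q+1)_m (H_q) = 0] for all [q > 0], then every class in [H^i_m] of
   [H_0 = M / (z)M] lifts to the total complex: the obstructions to extending
   a partial lift by one more step lie in these groups. *)
Lemma koszul_lift i t f :
    (forall q, (0 < q)%N -> ind_vanish (i + q).+1 (bound q) (cycle q)) ->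
    (forall S, #|S| != i -> f S = 0) -> (forall S, chain 0 (f S)) ->
    (forall S, bound 0 (wedge (vpow k t) f S)) ->
  exists u c, [/\ forall S, #|S| = i -> c S = push u f S,
    forall S q, #|S| = (i + q)%N -> chain q (c S),
    forall S, (#|S| < i)%N -> c S = 0 &
    forall S, wedge (vpow k (t + u)) c S + (-1) ^+ #|S| *: contr z (c S) = 0].
Proof.
move=> iv f0 fK fB.
have sK q := kchain_submod M q [set: 'I_s].
(* A lift through the degrees [i] to [i + r] whose next coboundary consists of Koszul boundaries.
   Taking [r = s] suffices, because there are no chains of degree above [s]. *)
suff H r : exists u c, [/\
    forall S, #|S| = i -> c S = push u f S,
    forall S q, #|S| = (i + q)%N -> chain q (c S),
    forall S, (#|S| < i)%N || (i + r < #|S|)%N -> c S = 0,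
    forall S, (#|S| <= i + r)%N ->
      wedge (vpow k (t + u)) c S + (-1) ^+ #|S| *: contr z (c S) = 0 &
    forall S, #|S| = (i + r).+1 -> bound r (wedge (vpow k (t + u)) c S)].
  have [u [c [ha hb hb' hc hd]]] := H s.
  exists u, c; split=> // S; first by move=> h; rewrite hb' // h.
  have [/hc//|h] := leqP #|S| (i + s); rewrite (hb' S) ?h ?orbT // contr0 scaler0 addr0.
  have [/hd[g /kchain_large -> // ->]|h'] := eqVneq #|S| (i + s).+1.
    exact: contr0.
  apply: wedge_eq0 => j jS; apply: hb'; apply/orP; right.
  by move: h h'; rewrite (cardsD1_eq jS) eqSS; lia.
elim: r => [|q [u [c [ha hb hb' hc hd]]]].
  exists 0%N, f; rewrite addn0 addn0; split=> [S _|S q hS|S hS|S hS|S _] //.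
  - by rewrite /push expr0 scale1r.
  - have [q0|q0] := posnP q; first by rewrite q0.
    rewrite f0; first exact: submod0 (sK q).
    by rewrite hS; lia.
  - by apply: f0; move: hS; lia.
  rewrite kchain0_contr // scaler0 addr0; apply: wedge_eq0 => j jS; apply: f0.
  by move: hS; rewrite (cardsD1_eq jS); lia.
pose D (c : {set 'I_n} -> V) := wedge (vpow k (t + u)) c.
(* The next term of the lift, determined only up to Koszul cycles. *)
have /choice[w hw] : forall S, exists v, [/\ chain q.+1 v,
    #|S| = (i + q).+1 -> contr z v = - (-1) ^+ #|S| *: D c S &
    #|S| <> (i + q).+1 -> v = 0].
  move=> S; have [hS|hS] := eqVneq #|S| (i + q).+1; last first.
    by exists 0; split=> // h; rewrite h eqxx in hS.
  have [g hg E] := hd S hS; exists (- (-1) ^+ #|S| *: g); split=> //.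
    exact: (submodZ (sK _)).
  by rewrite contrZ -E.
have w0 S : #|S| <> (i + q).+1 -> w S = 0 by case: (hw S).
have DDw S : #|S| <> (i + q).+2 -> D w S = 0.
  move=> hS; apply: wedge_eq0 => j jS; apply: w0 => h.
  by apply: hS; rewrite (cardsD1_eq jS) h.
(* The coboundary [D w] has values in the cycles, and its class is the obstruction. It vanishes
   after [push u'], and correcting [w] by the cycles [b] turns its coboundary into boundaries. *)
have [S hS|S|S|u' [b [b0 bZ bB]]] := iv q.+1 isT (t + u)%N (D w).
- by apply: DDw; move/eqP: hS; rewrite addnS.
- split; first by apply: (wedge_closed _ _ (sK _)) => T; case: (hw T).
  rewrite contr_wedge; have [hS|/eqP hS] := eqVneq #|S| (i + q).+2; last first.
    apply: wedge_eq0 => j jS; rewrite w0 ?contr0 // => h.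
    by apply: hS; rewrite (cardsD1_eq jS) h.
  transitivity (D (fun S => - (-1) ^+ (i + q).+1 *: D c S) S).
    apply: eq_bigr => j jS; congr (_ *: (_ *: _)).
    have h : #|S :\ j| = (i + q).+1 by move: hS; rewrite (cardsD1_eq jS) => -[].
    by case: (hw (S :\ j)) => _ -> //; rewrite h.
  by rewrite /D wedgeZ wedge_wedge scaler0.
- by rewrite wedge_wedge; exact: submod0 (kbound_submod _ _ _ _).
exists (u + u')%N, (fun S => push u' (fun S => c S + w S) S - b S).
have b0' S : #|S| <> (i + q).+1 -> b S = 0 by move=> /eqP h; apply: b0; rewrite addnS eqSS.
have DE S : wedge (vpow k (t + (u + u'))) (fun S => push u' (fun S => c S + w S) S - b S) S
    = varprod k S ^+ u' *: (D c S + D w S) - wedge (vpow k (t + u + u')) b S.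
  by rewrite wedgeB addnA -push_wedge wedgeD.
have Db S : #|S| <> (i + q).+2 -> wedge (vpow k (t + u + u')) b S = 0.
  move=> hS; apply: wedge_eq0 => j jS; apply: b0' => h.
  by apply: hS; rewrite (cardsD1_eq jS) h.
split=> S.
- move=> hS; rewrite /push b0' ?w0 ?hS; [|lia..]; rewrite subr0 addr0 ha // /push.
  by rewrite scalerA -exprD addnC.
- move=> q' hS; have [E|hq] := eqVneq q' q.+1; last first.
    rewrite /push b0' ?w0 ?hS; [|lia..]; rewrite subr0 addr0.
    by apply: (submodZ (sK _)); apply: hb.
  rewrite E in hS *; apply: (submodB (sK _)); last by case: (bZ S).
  apply: (submodZ (sK _)); apply: (submodD (sK _)); first exact: hb.
  by case: (hw S).
- move=> hS; rewrite /push b0' ?w0; [|lia..]; rewrite subr0 addr0 hb' ?scaler0 //.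
  by move: hS; lia.
- move=> hS; rewrite DE Db; [|lia]; rewrite subr0 DDw; [|lia].
  rewrite contrD contrN contrZ contrD; have [_ ->] := bZ S; rewrite subr0 addr0.
  rewrite scalerA mulrC -scalerA -scalerDr.
  have [E|hq] := eqVneq #|S| (i + q).+1; last first.
    by rewrite w0 ?contr0 ?addr0 ?hc ?scaler0 //; lia.
  have [_ -> // _] := hw S; rewrite hb' ?contr0 ?add0r; last by lia.
  by rewrite scalerA mulrN -exprD addnn -signr_odd odd_double scaleN1r subrr scaler0.
move=> hS; rewrite DE (_ : D c S = 0) ?add0r; last first.
  apply: wedge_eq0 => j jS; apply: hb'; move: hS; rewrite (cardsD1_eq jS); lia.
exact: bB.
Qed.

End Zigzag.

(** * Koszul and Cech complexes of graded modules *)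

Section Homology.
Variables (k : fieldType) (n : nat).
Local Notation R := {mpoly k[n]}.

Section Subquotient.
Variables (V : gmodule k n) (D : ghom V V) (A B : gsub V).

Lemma ghomology_rep (h : ghomology D A B) :
  exists2 f : gsubm (gcap A (gker D)), h = lmpi _ f & val f \in A /\ D (val f) = 0.
Proof.
exists (repr h); first by rewrite lmpi_repr.
by have := valP (repr h); rewrite !inE => /andP[? /eqP].
Qed.

Lemma ghomology_eq0 (f : gsubm (gcap A (gker D))) :
  lmpi (gpre (gincl (gcap A (gker D))) (gim D B)) f = 0 <->
  exists2 g, g \in B & val f = D g.
Proof.
rewrite -(lmpi0 (gpre (gincl (gcap A (gker D))) (gim D B))) lmpiP subr0.
by split=> /asboolP.
Qed.

Lemma ghomology_comp0 nu (x : R) :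
  (forall h : ghomology D A B, gcomp nu (x *: h) = 0) <->
  forall f, f \in A -> D f = 0 -> exists2 g, g \in B & gcomp nu (x *: f) = D g.
Proof.
split=> [H f fA Df|H h].
  have fZ : f \in gcap A (gker D) by rewrite !inE fA Df eqxx.
  pose f' : gsubm (gcap A (gker D)) := exist _ f fZ.
  have := H (lmpi _ f'); rewrite -lmpiZ /= gquot_compE => /ghomology_eq0.
  by case=> g gB E; exists g.
have [f -> [fA Df]] := ghomology_rep h.
rewrite -lmpiZ /= gquot_compE; apply/ghomology_eq0.
by have [g gB E] := H _ fA Df; exists g.
Qed.

Lemma ghomology_ann (x : R) : annihilator (ghomology D A B) x <->
  forall f, f \in A -> D f = 0 -> exists2 g, g \in B & x *: f = D g.
Proof.
split=> [H f fA Df|H h].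
  have fZ : f \in gcap A (gker D) by rewrite !inE fA Df eqxx.
  pose f' : gsubm (gcap A (gker D)) := exist _ f fZ.
  have := H (lmpi _ f'); rewrite -lmpiZ => /ghomology_eq0.
  by case=> g gB E; exists g.
have [f -> [fA Df]] := ghomology_rep h.
rewrite -lmpiZ; apply/ghomology_eq0.
by have [g gB E] := H _ fA Df; exists g.
Qed.
End Subquotient.

Lemma gsuppP (I : finType) (F : I -> gmodule k n) (P : pred I) (x : gprod F) :
  reflect (forall i, ~~ P i -> x i = 0) (x \in gsupp F P).
Proof.
rewrite inE; apply: (iffP forallP) => h i.
  by move=> /negPf Pi; have := h i; rewrite Pi => /eqP.
by case: (boolP (P i)) => //= /h ->.
Qed.

Section Koszul.
Variables (t : nat) (z : htuple k n t) (M : gmodule k n).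

Lemma koszul_cohomology_comp0 p nu (x : R) :
  (forall h : koszul_cohomology z M p, gcomp nu (x *: h) = 0) ->
  forall F : {set 'I_t} -> M, (forall U : {set 'I_t}, #|U| != p -> F U = 0) ->
    (forall U, wedge z F U = 0) ->
  exists2 G : {set 'I_t} -> M, forall U : {set 'I_t}, #|U|.+1 != p -> G U = 0 &
    forall U, gcomp (sdeg z U + nu) (x *: F U) = wedge z G U.
Proof.
move=> /ghomology_comp0 H F F0 dF.
pose F' : koszul_cochains z M := mkdprod (F : forall U : {set 'I_t}, gshift M (sdeg z U)).
have [||G /gsuppP G0 E] := H F'.
- by apply/gsuppP => U hU; rewrite mkdprodE F0.
- apply/dprodP => U; rewrite mkdprodE dprod0E -[RHS](dF U) /wedge.
  by apply: eq_bigr => i _; rewrite mkdprodE.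
exists (fun U => G U) => // U.
have := congr1 (fun f : koszul_cochains z M => f U) E.
by rewrite /= !mkdprodE.
Qed.

Lemma koszul_homology_ann q (x : R) : annihilator (koszul_homology z M q) x ->
  forall f, kcycle z q [set: 'I_t] f -> kbound (M := M) z q [set: 'I_t] (x *: f).
Proof.
move=> /ghomology_ann H f [f0 df].
pose F : koszul_chains z M := mkdprod (f : forall U : {set 'I_t}, gshift M (- sdeg z U)).
have [||G /gsuppP G0 E] := H F.
- by apply/gsuppP => U hU; rewrite mkdprodE f0 // (negPf hU).
- apply/dprodP => U; rewrite mkdprodE dprod0E.
  apply: etrans (congr1 (fun f => f U) df).
  by apply: eq_bigr => i _; rewrite mkdprodE.
exists (fun U => G U).
  by move=> U; rewrite finset.subsetT andbT; apply: G0.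
apply/funext => U; have := congr1 (fun f : koszul_chains z M => f U) E.
by rewrite /= !mkdprodE.
Qed.
End Koszul.

Section Cech.
Variable M : gmodule k n.

(** The map from the Koszul cochains of the X_i^t to the Cech cochains. The lemmas below show that
    it commutes with the differentials and with [push], that every Cech cochain of given degree
    comes from some [t], and that its kernel dies under [push]. *)
Definition cech_of t (f : {set 'I_n} -> M) : cech_cochains M :=
  mkdprod ((fun S => mkloc (varprod k S) (f S) t)
    : forall S : {set 'I_n}, gloc M (varprod_homog k S)).

Lemma cech_codiff_of t f : cech_codiff (cech_of t f) = cech_of t (wedge (vpow k t) f).
Proof.
apply/dprodP => S; rewrite !mkdprodE.
rewrite [RHS](big_morph (fun m => mkloc (varprod k S) m t)
  (fun m m' => mklocD _ m m' t) (mkloc0 M _ t)).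
apply: eq_bigr => i iS; rewrite mkdprodE (locmapE (varprodD1 k iS)).
exact/esym/mklocZ.
Qed.

Lemma cech_ofE t u f : cech_of (t + u) (push u f) = cech_of t f.
Proof. by apply/dprodP => S; rewrite !mkdprodE addnC mkloc_mul. Qed.

Lemma cech_rep p (h : cech_cochains M) :
    (forall S : {set 'I_n}, #|S| != p -> h S = 0) ->
  exists t f, (forall S : {set 'I_n}, #|S| != p -> f S = 0) /\ h = cech_of t f.
Proof.
move=> h0.
pose a (S : {set 'I_n}) := (repr (h S)).2; pose m (S : {set 'I_n}) := (repr (h S)).1.
exists (\sum_S a S)%N, (fun S : {set 'I_n} => if #|S| == p
  then varprod k S ^+ (\sum_(S' | S' != S) a S') *: m S else 0).
split=> [S /negPf -> //|]; apply/dprodP => S; rewrite mkdprodE.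
have [hS|hS] := eqVneq #|S| p; last by rewrite h0 // mkloc0.
by rewrite [X in mkloc _ _ X](bigD1 S) //= addnC mkloc_mul mkloc_repr.
Qed.

Lemma cech_of_eq0 t f : cech_of t f = 0 ->
  exists u, forall S, push u f S = 0.
Proof.
move=> E; have /choice[c hc] : forall S : {set 'I_n}, exists c, varprod k S ^+ c *: f S = 0.
  move=> S; have := congr1 (fun h : cech_cochains M => h S) E.
  rewrite mkdprodE dprod0E -(mkloc0 M (varprod k S) 0) => /mklocP[c].
  by rewrite scaler0; exists (c + 0)%N.
exists (\sum_S c S)%N => S; rewrite /push (bigD1 S) //= addnC exprD.
by rewrite -scalerA hc scaler0.
Qed.

(** A Cech cocycle comes from a Koszul cocycle for a large power. Dividing by
    [varprod k S ^+ (t + u)] lowers the degree by [#|S| * (t + u)], whence the shifted degree of the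
    numerator. *)
Lemma local_cohomology_comp0 p nu (x : R) :
    (forall t f, (0 < t)%N -> (forall S : {set 'I_n}, #|S| != p -> f S = 0) ->
      (forall S, wedge (vpow k t) f S = 0) ->
      exists u (g : {set 'I_n} -> M), (forall S : {set 'I_n}, #|S|.+1 != p -> g S = 0) /\
        forall S : {set 'I_n}, gcomp (nu + (#|S| * (t + u))%:Z) (x *: push u f S) =
          wedge (vpow k (t + u)) g S) ->
  forall h : local_cohomology M p, gcomp nu (x *: h) = 0.
Proof.
move=> H; apply/ghomology_comp0 => h /gsuppP h0 dh.
have [t [f [f0 E]]] := cech_rep h0.
have [u hu] : exists u, forall S, push u (wedge (vpow k t) f) S = 0.
  by apply: (@cech_of_eq0 t); rewrite -cech_codiff_of -E.
(* [u] would make the cochain a cocycle; [u.+1] also makes the exponent positive. *)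
have [|S hS|S|u' [g [g0 hg]]] := H (t + u.+1)%N (push u.+1 f).
- by rewrite addnS.
- by rewrite /push f0 ?scaler0.
- rewrite -push_wedge exprS -scalerA.
  by have := hu S; rewrite /push => ->; rewrite scaler0.
exists (cech_of (t + u.+1 + u') g).
  by apply/gsuppP => S hS; rewrite mkdprodE g0 // mkloc0.
rewrite /= cech_codiff_of E -(cech_ofE t u.+1) -(cech_ofE _ u').
apply/dprodP => S; rewrite mkdprodE [RHS]mkdprodE -hg.
rewrite -(gloc_compE (varprod_homog k S)) mklocZ.
apply: (congr1 (@gcomp k n (gloc M (varprod_homog k S)) nu)).
by rewrite !mkdprodE.
Qed.
End Cech.
End Homology.

(** * The Koszul complex of a concatenated family *)

Section TotalComplex.
Import mathcomp.boot.finset.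
Variables (R : comNzRingType) (n s : nat) (M : lmodType R).
Variables (y : 'I_n -> R) (z : 'I_s -> R) (x : 'I_(n + s) -> R).
Hypothesis xl : forall i, x (lshift s i) = y i.
Hypothesis xr : forall j, x (rshift n j) = z j.
Implicit Types (S : {set 'I_n}) (T : {set 'I_s}) (U : {set 'I_(n + s)}).

(* The second component is complemented: the Koszul cochain complex of the
   [z_j] is read as a chain complex. *)
Definition glue S T : {set 'I_(n + s)} :=
  [set l | match fintype.split l with inl i => i \in S | inr j => j \notin T end].
Definition lpart U : {set 'I_n} := [set i | lshift s i \in U].
Definition rpart U : {set 'I_s} := [set j | rshift n j \notin U].

Lemma glueK U : glue (lpart U) (rpart U) = U.
Proof.
apply/setP => l; rewrite inE.
by case: fintype.splitP => j E; rewrite inE ?negbK; congr (_ \in U); apply/val_inj.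
Qed.

Lemma in_glue_l S T i : (lshift s i \in glue S T) = (i \in S).
Proof. by rewrite inE (fintype.unsplitK (inl i)). Qed.

Lemma in_glue_r S T j : (rshift n j \in glue S T) = (j \notin T).
Proof. by rewrite inE (fintype.unsplitK (inr j)). Qed.

Lemma lpart_glue S T : lpart (glue S T) = S.
Proof. by apply/setP => i; rewrite inE in_glue_l. Qed.

Lemma rpart_glue S T : rpart (glue S T) = T.
Proof. by apply/setP => j; rewrite inE in_glue_r negbK. Qed.

Lemma sum_glue (F : 'I_(n + s) -> nat) S T :
  (\sum_(l in glue S T) F l =
   \sum_(i in S) F (lshift s i) + \sum_(j : 'I_s | j \notin T) F (rshift n j))%N.
Proof.
rewrite big_split_ord; congr (_ + _)%N; apply: eq_bigl => i.
  exact: in_glue_l.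
exact: in_glue_r.
Qed.

Lemma card_glue S T : (#|glue S T| + #|T|)%N = (#|S| + s)%N.
Proof.
rewrite -sum1_card sum_glue !sum1_card -addnA; congr (_ + _)%N.
rewrite -[X in _ = X]card_ord -(cardC (mem T)) addnC; congr (_ + _)%N.
Qed.

Lemma glueD1l S T i : glue S T :\ lshift s i = glue (S :\ i) T.
Proof.
apply/setP => l; rewrite -[l]fintype.splitK; case: (fintype.split l) => j /=.
  by rewrite in_setD1 !in_glue_l in_setD1 eq_lshift.
by rewrite in_setD1 !in_glue_r eq_rlshift.
Qed.

Lemma glueD1r S T j : glue S T :\ rshift n j = glue S (j |: T).
Proof.
apply/setP => l; rewrite -[l]fintype.splitK; case: (fintype.split l) => i /=.
  by rewrite in_setD1 !in_glue_l eq_lrshift.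
by rewrite in_setD1 !in_glue_r in_setU1 eq_rshift negb_or.
Qed.

Lemma sgn_sum t (i : 'I_t) (S : {set 'I_t}) :
  sgn R i S = (-1) ^+ (\sum_(j in S) (j < i)%N).
Proof.
rewrite /sgn -sum1_card; congr (_ ^+ _).
under eq_bigl do rewrite inE.
by rewrite big_mkcondr; apply: eq_bigr => j _; case: ltnP.
Qed.

Lemma sgn_glue_l S T i : sgn R (lshift s i) (glue S T) = sgn R i S.
Proof.
rewrite !sgn_sum sum_glue /= [X in (_ + X)%N]big1 ?addn0 // => j _.
by rewrite ltnNge (leq_trans (ltnW (ltn_ord i)) (leq_addr _ _)).
Qed.

(** Before the place of z_j come all of [S] and the elements below [j] outside [T]; modulo 2 the
    latter number [j] plus the elements of [T] below [j]. *)
Lemma sgn_glue_r S T j :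
  sgn R (rshift n j) (glue S T) = (-1) ^+ (#|S| + j) * sgn R j T.
Proof.
rewrite !sgn_sum sum_glue /= -exprD -[LHS]signr_odd -[RHS]signr_odd.
congr (_ ^+ nat_of_bool _); rewrite !oddD.
have -> : (\sum_(i in S) (i < n + j)%N = #|S|)%N.
  by rewrite -sum1_card; apply: eq_bigr => i _; rewrite ltn_addr.
have Ej : (\sum_(l in T) (l < j) + \sum_(l : 'I_s | l \notin T) (l < j) = j)%N.
  rewrite -[RHS]card_ord -sum1_card (big_ord_widen s (fun=> 1%N) (ltnW (ltn_ord j))).
  rewrite [RHS]big_mkcond [RHS](bigID (mem T)) /=.
  by congr (_ + _)%N; apply: eq_bigr => l _; case: ltnP.
rewrite -[in odd (nat_of_ord j)]Ej oddD -!addbA; congr (_ (+) _).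
under eq_bigr do rewrite ltn_add2l.
by rewrite [RHS]addbC -addbA addbb addbF.
Qed.

(* The sign [(-1) ^ j] between [hsgn T] and [hsgn (j |: T)] turns the cochain
   sign of [z_j] into its chain sign. *)
Definition hsgn T : R := (-1) ^+ (\sum_(j : 'I_s | j \notin T) j).

Lemma hsgnK T : hsgn T * hsgn T = 1.
Proof. by rewrite /hsgn -exprD addnn -signr_odd odd_double. Qed.

Lemma hsgnU1 j T : j \notin T -> hsgn T = (-1) ^+ j * hsgn (j |: T).
Proof.
move=> jT; rewrite /hsgn -exprD (bigD1 j) //=; congr (_ ^+ (_ + _)).
by apply: eq_bigl => l; rewrite in_setU1 negb_or andbC.
Qed.

Definition unglue (G : {set 'I_(n + s)} -> M) S : {set 'I_s} -> M :=
  fun T => hsgn T *: G (glue S T).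

(** Up to [hsgn], the codifferential of the concatenated family is the total differential of the
    double complex of cochains for [y] with values in chains for [z]. *)
Lemma wedge_glue G S T : hsgn T *: wedge x G (glue S T) =
  wedge y (unglue G) S T + (-1) ^+ #|S| *: contr z (unglue G S) T.
Proof.
have sumT (I : finType) (P : pred I) (F : I -> {set 'I_s} -> M) :
    (\sum_(i | P i) F i) T = \sum_(i | P i) F i T.
  by rewrite fct_sumE.
rewrite /wedge sumT big_split_ord /= scalerDr; congr (_ + _).
  rewrite scaler_sumr; apply: eq_big => [i|i iS]; first exact: in_glue_l.
  rewrite sgn_glue_l xl glueD1l /unglue /=.
  by rewrite !fctE !scalerA; congr (_ *: _); ring.
rewrite !scaler_sumr; apply: eq_big => [j|j]; first exact: in_glue_r.
rewrite in_glue_r => jT; rewrite sgn_glue_r xr glueD1r /unglue (hsgnU1 jT).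
rewrite !scalerA exprD; congr (_ *: _).
transitivity ((-1) ^+ j * (-1) ^+ j * (hsgn (j |: T) * (-1) ^+ #|S| * sgn R j T * z j)).
  by ring.
by rewrite -exprD addnn -[_ ^+ j.*2]signr_odd odd_double mul1r; ring.
Qed.

End TotalComplex.

(** * Families of positive degree containing powers of the variables *)

Section Irrelevant.
Variables (k : fieldType) (n : nat).
Local Notation R := {mpoly k[n]}.
Local Notation homog0 := (mcoeff (@mnm0 n)).

(** [supremum] is defined by choice, so bounds can be read off [krull_dim] only once a supremum is
    known to exist. *)
Lemma nat_supremums (A : set nat) : (exists r, A r) ->
  (supremums [set (r%:Z)%:E | r in A] !=set0)%classic.
Proof.
move=> [r0 Ar0]; have [[b hb]|nb] := pselect (exists b, forall r, A r -> (r <= b)%N).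
  have exA : exists r, `[< A r >] by exists r0; apply/asboolP.
  case: (@ex_maxnP (fun r => `[< A r >]) b exA) => [r /asboolP/hb //|m /asboolP Am mmax].
  exists (m%:Z)%:E; split=> [_ [r Ar <-]|e he].
    by rewrite lee_fin lez_nat; apply: mmax; apply/asboolP.
  by apply: he; exists m.
exists +oo%E; split=> [_ [r Ar <-]|e he]; first exact: leey.
case: e he => [b hb| |hb] //; last by have := hb _ (ex_intro2 _ _ r0 Ar0 erefl).
case: nb; exists `|b|%N => r Ar; have := hb _ (ex_intro2 _ _ r Ar erefl).
rewrite lee_fin; lia.
Qed.

Lemma krull_dim_lt (N : lmodType R) i : (krull_dim N <= (i%:Z)%:E)%E ->
  dim_lt (annihilator N) i.+1.
Proof.
move=> hi r hr; rewrite ltnS -lez_nat -lee_fin; apply: le_trans hi.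
apply: ge_supremum_Nmem; last by exists r.
by apply: nat_supremums; exists r.
Qed.

Lemma krull_dim0 (N : lmodType R) : prime_chain (annihilator N) 0 ->
  dim_lt (annihilator N) 1 -> krull_dim N = 0%E.
Proof.
move=> h0 h1; rewrite /krull_dim (_ : image _ _ = [set 0%E])%classic ?supremum1 //.
apply/seteqP; split=> [_ [r /h1 + <-]|_ ->]; last by exists 0%N.
by rewrite ltnS leqn0 => /eqP->.
Qed.

Lemma irrelevant_decomp (I : R -> Prop) (f : R) : @submod R R^o I ->
  (forall i, I (var k i)) -> I (f - mpolyC n (homog0 f)).
Proof.
move=> iI Iv; pose Q (f : R) := I (f - mpolyC n (homog0 f)).
have QD f1 f2 : Q f1 -> Q f2 -> Q (f1 + f2).
  move=> h1 h2; rewrite /Q raddfD /= raddfD /= opprD addrACA.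
  exact: (submodD iI).
suff QX (a : k) m : Q (a *: mpolyX k m).
  rewrite -/(Q f) (mpolyE f); elim/big_ind: _ => //.
  by rewrite /Q mcoeff0 mpolyC0 subrr; exact: submod0 iI.
have [->|m0] := eqVneq m mnm0.
  rewrite /Q mpolyX0 mcoeffZ mcoeff1 eqxx mulr1 -mul_mpolyC mulr1 subrr.
  exact: submod0 iI.
have [i mi] : exists i, (0 < m i)%N.
  apply: contrapT => h; move/eqP: m0; apply; apply/mnmP => i; rewrite mnmE.
  by apply/eqP; rewrite -leqn0 leqNgt; apply/negP => hi; apply: h; exists i.
rewrite /Q mcoeffZ mcoeffX (negPf m0) mulr0 mpolyC0 subr0 -mul_mpolyC.
rewrite -(@submK _ (mnm1 i) m); last first.
  by apply/mnm_lepP => j; rewrite mnm1E; case: eqP => [<-|].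
by rewrite mpolyXD; apply: (idealM _ iI (idealM _ iI (Iv i))).
Qed.

(** Terms of [a] of positive degree reach degree [nu] only from components of [v] below [nu], which
    are zero. *)
Lemma gcomp_lowest (M : gmodule k n) nu (a : R) (v : M) :
  (forall nu', nu' < nu -> gcomp nu' v = 0) ->
  gcomp nu (a *: v) = mpolyC n (homog0 a) *: gcomp nu v.
Proof.
move=> hv; pose Q (a : R) := gcomp nu (a *: v) = mpolyC n (homog0 a) *: gcomp nu v.
rewrite -/(Q a) (mpolyE a); elim/big_ind: _ => [|a1 a2 h1 h2|m _].
- by rewrite /Q mcoeff0 mpolyC0 !scale0r gcomp0.
- by rewrite /Q scalerDl gcompD h1 h2 -scalerDl !raddfD.
have hX : mcoeff m a *: mpolyX k m \is (mdeg m).-homog.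
  by apply: dhomogZ; rewrite dhomogX.
rewrite /Q (gcompZi _ _ hX) mcoeffZ mcoeffX.
have [->|m0] := eqVneq m mnm0.
  by rewrite mpolyX0 mdeg0 subr0 mulr1 -mul_mpolyC mulr1.
rewrite mulr0 mpolyC0 scale0r hv ?scaler0 // ltrBlDr ltrDl.
by rewrite ltz_nat lt0n mdeg_eq0.
Qed.

Lemma finitely_generated_bounded (M : gmodule k n) : finitely_generated M ->
  exists b, forall nu, nu < b -> forall v : M, gcomp nu v = 0.
Proof.
move=> [r [g hg]].
have /choice[c hc] : forall i, exists c : nat, forall nu, nu < - c%:Z -> gcomp nu (g i) = 0.
  move=> i; have [s us E] := gcomp_sum (g i).
  exists (\sum_(d <- s) `|d|)%N => nu hnu; rewrite E gcomp_bigsum big_seq big1 // => d ds.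
  rewrite gcompK; case: eqP => // nud; move: hnu.
  rewrite nud (big_rem d ds) /=; lia.
exists (- (\sum_i c i)%N%:Z) => nu hnu v; have [a ->] := hg v.
rewrite gcomp_bigsum big1 // => i _.
have hnu' nu' : nu' <= nu -> gcomp nu' (g i) = 0.
  by move=> h; apply: hc; move: hnu; rewrite (bigD1 i) //=; lia.
rewrite gcomp_lowest ?hnu' ?scaler0 // => nu' /ltW; exact: hnu'.
Qed.

Lemma lowest_component (M : gmodule k n) : finitely_generated M ->
  (exists v : M, v <> 0) ->
  exists nu (v : M), [/\ v <> 0, gcomp nu v = v &
    forall nu', nu' < nu -> forall w : M, gcomp nu' w = 0].
Proof.
move=> /finitely_generated_bounded[b hb] [v v0].
pose P j := `[< exists w : M, gcomp (b + j%:Z) w <> 0 >].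
have exP : exists j, P j.
  apply: contrapT => nP; apply: v0; have [s _ ->] := gcomp_sum v.
  rewrite big1 // => d _; have [db|bd] := ltP d b; first exact: hb.
  apply: contrapT => h; apply: nP; exists `|d - b|%N; apply/asboolP; exists v.
  by rewrite (_ : b + _ = d) //; lia.
case: (ex_minnP exP) => j /asboolP[w hw] jmin.
exists (b + j%:Z), (gcomp (b + j%:Z) w); split=> //; first by rewrite gcompK eqxx.
move=> nu' hnu' w'; have [db|bd] := ltP nu' b; first exact: hb.
apply: contrapT => h; have /jmin : P `|nu' - b|%N.
  by apply/asboolP; exists w'; rewrite (_ : b + _ = nu') //; lia.
lia.
Qed.

(** Only the irrelevant ideal lies above the annihilator of M / (z)M. It does so because the lowest
    component of [M] meets (z)M in 0, so an annihilating element has zero constant term; any other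
    prime above would also contain all the variables. *)
Lemma krull_dim_tquot0 (M : gmodule k n) t (z : htuple k n t) :
    finitely_generated M -> (exists v : M, v <> 0) ->
    (forall i, 0 < ht_deg z i)%N -> (forall i, exists j e, z j = var k i ^+ e) ->
  krull_dim (tquot z M) = 0%E.
Proof.
move=> fgM nzM zpos zvar.
have lmpi_eq0 (w : M) : lmpi (tmul z M) w = 0 <-> exists m, w = \sum_i z i *: m i.
  by rewrite -(lmpi0 (tmul z M)) lmpiP subr0; split=> /asboolP.
have [nu [v [v0 vE low]]] := lowest_component fgM nzM.
have homog0M (p q : R) : homog0 (p * q) = homog0 p * homog0 q.
  exact: (mcoeff0_is_multiplicative n k).1.
apply: krull_dim0.
  exists (fun=> fun f => homog0 f == 0); split=> // i _; split.
  - split; rewrite ?inE /in_mem /= ?mcoeff0 ?mcoeff1 ?eqxx ?oner_eq0 //.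
    move=> a u w; rewrite /in_mem /= => /eqP hu /eqP hw.
    by rewrite mcoeffD homog0M hu hw mulr0 addr0.
  - by move=> u w; rewrite /in_mem /= homog0M mulf_eq0.
  move=> f Af; rewrite /in_mem /=; apply/negP => /negP f0; apply: v0.
  have /lmpi_eq0[m E] : lmpi (tmul z M) (f *: v) = 0 by rewrite lmpiZ; apply: Af.
  have : gcomp nu (f *: v) = 0.
    rewrite E gcomp_bigsum big1 // => l _.
    rewrite (gcompZi _ _ (ht_homog z l)) low ?scaler0 //.
    by rewrite ltrBlDr ltrDl ltz_nat.
  rewrite gcomp_lowest => [|nu' /low //]; rewrite vE => h.
  rewrite -[v]scale1r -(mpolyC1 n k) -(mulVf f0) mpolyCM -scalerA h scaler0 //.
(* In a longer chain [p 0] contains the variables; an element of [p 1] outside [p 0] then has a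
   nonzero constant term, which puts 1 in [p 1]. *)
move=> [|r] // [p [hp sp]]; exfalso.
have [ip0 pp0 Ap0] := hp 0%N isT; have [ip1 pp1 Ap1] := hp 1%N isT.
have [p01 [x xp1 /negP[]]] := sp 0%N isT.
have var0 i : var k i \in p 0%N.
  have [j [e E]] := zvar i; apply: (@prime_expr _ _ _ _ e) => //; rewrite -E.
  apply: Ap0 => w; rewrite -[w]lmpi_repr -lmpiZ; apply/lmpi_eq0.
  exists (fun l => if l == j then repr w else 0).
  by rewrite (bigD1 j) //= eqxx big1 ?addr0 // => l /negPf ->; rewrite scaler0.
have pD (q : {pred R}) : idealr_closed q -> @submod R R^o (fun f => f \in q).
  by move=> [q0 _ qD]; split=> // a u w hu hw; apply: qD.
have xc := irrelevant_decomp x (pD _ ip0) var0.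
have [x0|x0] := eqVneq (homog0 x) 0; first by move: xc; rewrite x0 mpolyC0 subr0.
have cp1 : mpolyC n (homog0 x) \in p 1%N.
  by rewrite -[mpolyC _ _](subKr x); apply: (submodB (pD _ ip1)) => //; apply: p01.
have I1 := pD _ ip1; case: ip1 => _ /negP[]; rewrite -(mpolyC1 n k) -(mulVf x0) mpolyCM.
exact: (@idealM _ (fun f => f \in p 1%N) _ _ I1 cp1).
Qed.

End Irrelevant.

(** * Comparison of annihilators *)

Section Comparison.
Import mathcomp.boot.finset.
Variables (k : fieldType) (n : nat).
Local Notation R := {mpoly k[n]}.

Lemma vpow_homog t (i : 'I_n) : vpow k t i \is t.-homog.
Proof.
have hX : var k i \is 1.-homog by rewrite dhomogX; apply/eqP/mdeg1.
by have := dhomogMn t hX; rewrite mul1n.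
Qed.
Definition vtuple t : htuple k n n := HTuple (vpow_homog t).

Section Cat.
Variables (a b : nat) (z : htuple k n a) (w : htuple k n b).
Definition cat_val (l : 'I_(a + b)) : R :=
  match fintype.split l with inl i => z i | inr j => w j end.
Definition cat_deg (l : 'I_(a + b)) : nat :=
  match fintype.split l with inl i => ht_deg z i | inr j => ht_deg w j end.
Fact cat_homog l : cat_val l \is (cat_deg l).-homog.
Proof. by rewrite /cat_val /cat_deg; case: fintype.split => i; apply: ht_homog. Qed.
Definition cat_htuple : htuple k n (a + b) := HTuple cat_homog.

Lemma cat_valE_l i : cat_htuple (lshift b i) = z i.
Proof. by rewrite /= /cat_val (fintype.unsplitK (inl i)). Qed.
Lemma cat_valE_r i : cat_htuple (rshift a i) = w i.
Proof. by rewrite /= /cat_val (fintype.unsplitK (inr i)). Qed.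
Lemma cat_degE_l i : ht_deg cat_htuple (lshift b i) = ht_deg z i.
Proof. by rewrite /= /cat_deg (fintype.unsplitK (inl i)). Qed.
Lemma cat_degE_r i : ht_deg cat_htuple (rshift a i) = ht_deg w i.
Proof. by rewrite /= /cat_deg (fintype.unsplitK (inr i)). Qed.
End Cat.

Variable M : gmodule k n.
Hypothesis fgM : finitely_generated M.

Lemma sdeg_vtuple t (S : {set 'I_n}) : sdeg (vtuple t) S = (#|S| * t)%N%:Z.
Proof. by rewrite /sdeg sum_nat_const. Qed.

Lemma ann_local_cohomology i (N : \bar int) (x : R) :
  (forall t (z : htuple k n t), ZM M z -> ann_gt N (koszul_cohomology z M i) x) ->
  ann_gt N (local_cohomology M i) x.
Proof.
move=> H nu Nnu; apply: local_cohomology_comp0 => t f t0 f0 df.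
(* If [M = 0], then M / (z)M has dimension -oo and no tuple is in Z_M, so this case is treated
   directly. *)
have [M0|nM0] := pselect (forall v : M, v = 0).
  by exists 0%N, (fun=> 0); split=> // S; rewrite wedge0; apply: M0.
have zZ : ZM M (vtuple t).
  split=> //; apply: krull_dim_tquot0 => //.
    by apply: contrapT => h; apply: nM0 => v; apply: contrapT => v0; apply: h; exists v.
  by move=> i'; exists i', t.
have [G G0 GE] := koszul_cohomology_comp0 (H _ _ zZ nu Nnu) f0 df.
exists 0%N, G; split=> // S.
by rewrite /push expr0 scale1r addn0 -GE sdeg_vtuple addrC.
Qed.

Section Quotient.
Variables (s : nat) (gam : htuple k n s).
Hypothesis gam_pos : forall j, (0 < ht_deg gam j)%N.
Local Notation V := ({set 'I_s} -> M).

Lemma koszul_span : exists l : seq V, forall v, lspan l v.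
Proof.
have [r [g hg]] := fgM.
pose single (T : {set 'I_s}) (v : M) : V := fun T' => if T' == T then v else 0.
exists [seq single Ti.1 (g Ti.2) | Ti <- enum {: {set 'I_s} * 'I_r}] => v.
have sl := lspan_submod [seq single Ti.1 (g Ti.2) | Ti <- enum {: {set 'I_s} * 'I_r}].
have -> : v = \sum_T single T (v T).
  apply/funext => T; rewrite fct_sumE (bigD1 T) //= {1}/single eqxx big1 ?addr0 //.
  by move=> T' /negPf h; rewrite /single eq_sym h.
apply: submod_sum => // T _; have [a ->] := hg (v T).
have -> : single T (\sum_i a i *: g i) = \sum_i a i *: single T (g i).
  apply/funext => T'; rewrite fct_sumE /single; case: eqVneq => [->|h].
    by apply: eq_bigr => i _; rewrite !fctE eqxx.
  by rewrite big1 // => i _; rewrite !fctE (negPf h) scaler0.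
apply: submod_sum => // i _; apply: (submodZ sl); apply: lspan_mem.
by apply/mapP; exists (T, i) => //; rewrite mem_enum.
Qed.

(** By rigidity the annihilator of H_1 is contained in the radical of that of H_q, so the latter has
    dimension at most [i], below the degree [(i + q).+1]. *)
Lemma koszul_ind_vanish i : (krull_dim (koszul_homology gam M 1) <= (i%:Z)%:E)%E ->
  forall q, (0 < q)%N ->
  ind_vanish (i + q).+1 (kbound (M := M) gam q [set: 'I_s]) (kcycle gam q [set: 'I_s]).
Proof.
move=> /krull_dim_lt dH q q0.
have [l hl] := koszul_span.
have noe (A : V -> Prop) : submod A -> spanned_by_finite A.
  by move=> sA; apply: (noetherian_module (l := l)) => //; apply: hilbert_basis.
pose J (a : R) := forall f, kcycle (M := M) gam q [set: 'I_s] f ->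
  kbound gam q [set: 'I_s] (a *: f).
have sB := kbound_submod M gam q [set: 'I_s].
apply: (@dim_ind_vanish _ _ _ J _ _ i.+1).
- split=> [f _|a u v hu hv f hf]; first by rewrite scale0r; exact: submod0 sB.
  have -> : (a *: (u : R^o) + v) *: f = a *: (u *: f) + v *: f by rewrite scalerDl -scalerA.
  by apply: sB.2; [exact: hu | exact: hv].
- exact: sB.
- exact: kcycle_submod.
- by move=> v; apply: kbound_cycle.
- by move=> a b Ja /Ja.
- apply: dim_lt_radical dH => a /koszul_homology_ann Ha.
  by have [e he] := koszul_rigidity noe Ha; exists e => f; apply: he.
- by rewrite ltnS leq_addr.
Qed.

(** The -1 in each summand of sigma accounts for the passage from cohomological degree [i] to
    [i + s]. *)
Lemma koszul_degree_shift i (mu : \bar int) (nu : int) :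
  (mu + (\sum_(j < s) ((ht_deg gam j)%:Z - 1))%:E - (i%:Z)%:E < nu%:E)%E ->
  (mu - ((i + s)%N%:Z)%:E < (nu - (\sum_j ht_deg gam j)%N%:Z)%:E)%E.
Proof.
rewrite sumrB sumr_const card_ord -(big_morph Posz PoszD (erefl _)).
case: mu => [r| |] //=; rewrite ?lte_fin; last by move=> _; exact: ltNyr.
lia.
Qed.

Implicit Types (S : {set 'I_n}) (T : {set 'I_s}) (U : {set 'I_(n + s)}).

(** A class is lifted to the total complex and read as a Koszul cocycle of (X_0^(t+u), ..., gamma)
    on [M], to which the hypothesis applies. The entries at the empty [T] of the resulting cochain,
    taken modulo (gamma)M, give the coboundary sought. *)
Lemma ann_local_cohomology_tquot i (mu : \bar int) (x : R) :
  (krull_dim (koszul_homology gam M 1) <= (i%:Z)%:E)%E ->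
  (forall t (z : htuple k n t), ZM M z ->
    ann_gt (mu - ((i + s)%N%:Z)%:E)%E (koszul_cohomology z M (i + s)) x) ->
  CCi i (mu + (\sum_(j < s) ((ht_deg gam j)%:Z - 1))%:E)%E (tquot gam M) x.
Proof.
move=> hi H nu /koszul_degree_shift hnu.
apply: local_cohomology_comp0 => t f t0 f0 df.
have pi_eq0 (w : M) : lmpi (tmul gam M) w = 0 <-> exists m, w = \sum_i gam i *: m i.
  by rewrite -(lmpi0 (tmul gam M)) lmpiP subr0; split=> /asboolP.
pose pi := lmpi (tmul gam M).
have [M0|nM0] := pselect (forall v : M, v = 0).
  exists 0%N, (fun=> 0); split=> // S; rewrite wedge0.
  have Q0 (w : tquot gam M) : w = 0 by rewrite -[w]lmpi_repr [repr w]M0 lmpi0.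
  exact: Q0.
pose m (S : {set 'I_n}) : M := if #|S| == i then repr (f S) else 0.
have piD (I : finType) (P : pred I) (F : I -> M) :
    pi (\sum_(i | P i) F i) = \sum_(i | P i) pi (F i).
  exact: (big_morph pi (@lmpiD _ _ _) (lmpi0 _)).
have pi_wedge u (g : {set 'I_n} -> M) S :
    pi (wedge (vpow k u) g S) = wedge (vpow k u) (fun S => pi (g S) : tquot gam M) S.
  rewrite /wedge piD; apply: eq_bigr => j _; rewrite /pi !lmpiZ //.
have pim S : pi (m S) = f S.
  by rewrite /m; case: eqP => [_|/eqP/f0 ->]; [exact: lmpi_repr | exact: lmpi0].
pose F0 (S : {set 'I_n}) : V := fun T : {set 'I_s} => if T == finset.set0 then m S else 0.
have [S hS|S T|S|u [c [c_i c_q c_lt dc]]] := koszul_lift (f := F0) (t := t) (koszul_ind_vanish hi).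
- by apply/funext => T; rewrite /F0 /m (negPf hS) if_same.
- by rewrite /F0 => hT; case: eqP => // T0; rewrite T0 cards0 finset.sub0set in hT.
- have [w E] : exists w : 'I_s -> M, wedge (vpow k t) m S = \sum_i gam i *: w i.
    apply/pi_eq0; rewrite -/pi pi_wedge -[RHS](df S); apply: eq_bigr => j _.
    by rewrite pim.
  (* The 1-chain with value [w j] at the singleton of [j] and 0 elsewhere. *)
  exists (fun T : {set 'I_s} => \sum_(j | T == [set j]%SET) w j).
    move=> T hT; rewrite big1 // => j /eqP Tj; move: hT.
    by rewrite Tj cards1 finset.subsetT.
  apply/funext => T; rewrite {1}/wedge fct_sumE.
  have [T0|T0] := eqVneq T finset.set0.
    transitivity (wedge (vpow k t) m S).
      by apply: eq_bigr => j jS; rewrite /F0 T0 !fctE eqxx.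
    rewrite E /contr T0; apply: eq_big => [j|j _]; first by rewrite inE.
    rewrite /sgn (_ : [set j0 in finset.set0 | _]%SET =
      finset.set0) ?cards0 ?expr0 ?scale1r; last first.
      by apply/setP => l; rewrite !inE.
    rewrite setU0 (bigD1 j) //= big1 ?addr0 // => l /andP[/eqP/set1_inj -> /eqP] //.
  rewrite big1 => [|j _]; last by rewrite /F0 !fctE (negPf T0) !scaler0.
  rewrite /contr big1 // => j jT; rewrite big1 ?scaler0 // => l /eqP E'.
  have /eqP := congr1 (fun A : {set 'I_s} => #|A|) E'.
  by rewrite cardsU1 jT cards1 eqSS cards_eq0 (negPf T0).
pose z := cat_htuple (vtuple (t + u)) gam.
have zl j : z (lshift s j) = vpow k (t + u) j by exact: cat_valE_l.
have zr j : z (rshift n j) = gam j by exact: cat_valE_r.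
have zZ : ZM M z.
  split=> [l|].
    rewrite /= /cat_deg; case: fintype.split => j //=.
    by rewrite ltn_addr.
  apply: krull_dim_tquot0 => //.
  - by apply: contrapT => h; apply: nM0 => v; apply: contrapT => v0; apply: h; exists v.
  - move=> l; rewrite /= /cat_deg; case: fintype.split => j //=.
    by rewrite ltn_addr.
  by move=> j; exists (lshift s j), (t + u)%N; rewrite zl.
(* The lift as a cochain of the concatenated family: [c S] has chain degree [#|S| - i], so [F] has
   degree [i + s]. *)
pose F (U : {set 'I_(n + s)}) := hsgn R (rpart U) *: c (lpart U) (rpart U).
have F_unglue : unglue F = c.
  apply/funext => S; apply/funext => T.
  by rewrite /unglue /F lpart_glue rpart_glue scalerA hsgnK scale1r.
have Fdeg U : #|U| != (i + s)%N -> F U = 0.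
  move=> hU; have := card_glue (lpart U) (rpart U); rewrite glueK => cU.
  rewrite /F; have [lt|le] := ltnP #|lpart U| i; first by rewrite c_lt // scaler0.
  rewrite (c_q _ (#|lpart U| - i)%N) ?subnKC ?scaler0 //.
  apply: contra hU => /andP[/eqP E _]; lia.
have dF U : wedge z F U = 0.
  have := wedge_glue zl zr F (lpart U) (rpart U); rewrite glueK F_unglue.
  have := congr1 (fun v : V => v (rpart U)) (dc (lpart U)).
  rewrite !fctE => -> /(congr1 (fun v => hsgn R (rpart U) *: v)).
  by rewrite scalerA hsgnK scale1r scaler0.
have [G G0 GE] := koszul_cohomology_comp0 (H _ _ zZ _ hnu) Fdeg dF.
have gdeg (S : {set 'I_n}) : #|S|.+1 != i -> pi (unglue G S finset.set0) = 0.
  move=> hS; rewrite /unglue G0 ?scaler0; first exact: lmpi0.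
  have := card_glue S finset.set0 (s := s); rewrite cards0 addn0 => ->.
  by rewrite -addSn eqn_add2r.
exists u, (fun S => pi (unglue G S finset.set0)); split=> // S.
have [hS|hS] := eqVneq #|S| i; last first.
  by rewrite /push f0 // !scaler0 gcomp0 (wedge_deg _ gdeg) //.
have -> : push u f S = pi (c S finset.set0).
  by rewrite c_i // /push -pim /F0 /= fctE eqxx /pi lmpiZ.
rewrite -pi_wedge /pi -lmpiZ /= gquot_compE.
apply/lmpiP.
have hsgn_homog T : hsgn R T \is 0.-homog.
  rewrite /hsgn -signr_odd; case: odd; rewrite ?expr0 ?expr1 ?rpredN; exact: dhomog1.
have -> : c S finset.set0 = hsgn R (finset.set0 : {set 'I_s}) *: F (glue S finset.set0).
  by rewrite /F lpart_glue rpart_glue scalerA hsgnK scale1r.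
rewrite scalerA mulrC -scalerA (gcompZi _ _ (hsgn_homog _)) subr0.
(* At the empty [T] the glued set contains every index of gamma, whence the shift by the sum of the
   degrees. *)
have -> : nu + (#|S| * (t + u))%N%:Z =
    sdeg z (glue S finset.set0) + (nu - (\sum_j ht_deg gam j)%N%:Z).
  rewrite /sdeg sum_glue.
  have -> : (\sum_(j in S) ht_deg z (lshift s j) = #|S| * (t + u))%N.
    by rewrite -sum_nat_const; apply: eq_bigr => j _; rewrite cat_degE_l.
  have -> : (\sum_(j : 'I_s | j \notin finset.set0) ht_deg z (rshift n j) =
      \sum_j ht_deg gam j)%N.
    by apply: eq_big => [j|j _]; [rewrite inE | rewrite cat_degE_r].
  by rewrite PoszD addrACA subrr addr0 addrC.
(* Besides the coboundary there remains a [contr] term, a combination of the [gam j], which is zero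
   modulo (gamma)M. *)
rewrite GE (wedge_glue zl zr) addrAC {1}/wedge fct_sumE.
rewrite -[X in X - _]/(wedge (vpow k (t + u)) (fun S => unglue G S finset.set0) S).
rewrite subrr add0r rpredZ //; apply/asboolP.
exists (fun j => sgn R j finset.set0 *: unglue G S (j |: finset.set0)%SET).
by rewrite /contr; apply: eq_big => [j|j _]; [rewrite finset.in_set0 |
  rewrite [LHS]scalerA [in LHS]mulrC -scalerA].
Qed.
End Quotient.
End Comparison.

(** * Inclusions between the Koszul and the local cohomology annihilators *)

Local Open Scope classical_set_scope.
Local Open Scope ring_scope.

Theorem proposition2p1 (k : fieldType) (n : nat) (M : gmodule k n.+1)
    (hM : finitely_generated M) (mu : \bar int) (hmu : mu != +oo%E) :
  (KK mu M `<=` CC mu M /\ KKhat mu M `<=` CChat mu M) /\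
  forall (s : nat) (gamma : htuple k n.+1 s), partial_sop M gamma ->
    let d := krull_dim M in
    let eps := krull_dim (koszul_homology gamma M 1) in
    let sigma : int := \sum_(i < s) ((ht_deg gamma i)%:Z - 1) in
    (forall i : nat, (eps <= (i%:Z)%:E)%E -> ((i%:Z)%:E < d - (s%:Z)%:E)%E ->
       KKhat mu M `<=` CCi i (mu + sigma%:E)%E (tquot gamma M)) /\
    (forall i : nat, (eps <= (i%:Z)%:E)%E ->
       KK mu M `<=` CCi i (mu + sigma%:E)%E (tquot gamma M)).
Proof.
split; first split.
- by move=> x xK i _; apply: ann_local_cohomology => // t z zZ; exact: xK t z zZ i.
- by move=> x xK i id; apply: ann_local_cohomology => // t z zZ; exact: xK t z zZ i id.
move=> s gamma [gpos _] d eps sigma; split=> [i ei id x xK|i ei x xK].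
  (* The Koszul cohomology used has degree [i + s], so [i < d - s] is what the truncated ideal
     requires. *)
  have lt : (((i + s)%N%:Z)%:E < krull_dim M)%E.
    move: id; rewrite -/d; case: d => [r| |] //; rewrite ?lte_fin; lia.
  by apply: ann_local_cohomology_tquot => // t z zZ; exact: xK t z zZ _ lt.
by apply: ann_local_cohomology_tquot => // t z zZ; exact: xK t z zZ (i + s)%N.
Qed.
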